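(* Let $f\in C^1(\mathbb{R}^2,\mathbb{R}^2)$, let $T>0$, and let $x_0$ be a nondegenerate $T$-periodic cycle of $\dot x=f(x)$. Let $g:\mathbb{R}\times\mathbb{R}^2\times[0,1]\to K(\mathbb{R}^2)$ be $T$-periodic in its first variable and measurable, and assume that for every bounded set $B\subset\mathbb{R}^2$ there is $\mu_B\in L^\infty_{loc}(\mathbb{R})$ with $\sup\{\|y\|: y\in g(t,x,\varepsilon)\}\le \mu_B(t)$ for all $t\in\mathbb{R}$, $x\in B$, $\varepsilon\in[0,1]$. For all sufficiently small $\varepsilon>0$ let $x_\varepsilon$ be a $T$-periodic solution of $\dot x\in f(x)+\varepsilon g(t,x,\varepsilon)$ such that $\|x_\varepsilon(t)-x_0(t)\|\to 0$ as $\varepsilon\to0$ uniformly with respect to $t\in[0,T]$. Let $A_1\in\mathbb{R}^2$ be any vector such that the $2\times2$ matrix $(\dot x_0(0),A_1)$ is nonsingular, and let $S(v)=\Omega(T,0,x_0(0)+A_1v)$. Then there exist $\varepsilon_0>0$, $r_0>0$ and $M>0$ such that for every $\varepsilon\in(0,\varepsilon_0]$ the equation $x_\varepsilon(\Delta)=S(v)$ has a unique solution $(\Delta_\varepsilon,v_\varepsilon)\in[-r_0,r_0]\times[-r_0,r_0]$, with $\Delta_\varepsilon\to0$ and $v_\varepsilon\to0$ as $\varepsilon\to0$, and $$\|x_\varepsilon(t+\Delta_\varepsilon)-x_0(t)\|\le M\varepsilon\quad\text{for any } t\in[0,T]\text{ and any }\varepsilon\in(0,\varepsilon_0].$$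
   Context: $K(\mathbb{R}^2)$ is the set of nonempty compact convex subsets of $\mathbb{R}^2$. A $T$-periodic cycle of $\dot x=f(x)$ is a nonconstant periodic solution with smallest period $T$. The cycle $x_0$ is called nondegenerate if the linearized system $\dot y=f'(x_0(t))y$ has a solution that is not $T$-periodic. $\Omega(\cdot,t_0,\xi)$ denotes the solution of $\dot x=f(x)$ with $\Omega(t_0,t_0,\xi)=\xi$; $S(v)$ is considered for those $v$ (in particular all $v$ near $0$) for which $\Omega(T,0,x_0(0)+A_1v)$ is defined. The multivalued map $g$ is measurable if for every $\varepsilon$ and every open $V\subset\mathbb{R}^2$ the set $\{(t,x)\in\mathbb{R}\times\mathbb{R}^2: g(t,x,\varepsilon)\cap V\neq\emptyset\}$ is measurable. A solution of the differential inclusion is an absolutely continuous function satisfying the inclusion for almost all $t$; a $T$-periodic solution is a $T$-periodic function on $\mathbb{R}$ that is absolutely continuous on bounded intervals and satisfies the inclusion for almost all $t\in\mathbb{R}$. *)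

(* Defs.v *)
(* The plane is the normed module ['rV[R]_2] of row vectors; its norm is the
   maximum of the absolute values of the coordinates. *)
From HB Require Import structures.
From mathcomp Require Import all_boot all_order all_algebra.
From mathcomp Require Import all_classical all_reals all_analysis.
From mathcomp Require Import measurable_realfun.

Set Implicit Arguments.
Unset Strict Implicit.
Unset Printing Implicit Defensive.

Import Order.TTheory GRing.Theory Num.Theory.
Import numFieldNormedType.Exports.

Local Open Scope classical_set_scope.
Local Open Scope ring_scope.

Definition C1_map (R : realType) (f : 'rV[R]_2 -> 'rV[R]_2) : Prop :=
  (forall x, differentiable f x) /\ continuous (jacobian f).

Definition is_periodic (R : realType) (U : Type) (T : R) (x : R -> U) : Prop :=
  forall t, x (t + T) = x t.

Definition ode_solution (R : realType) (f : 'rV[R]_2 -> 'rV[R]_2)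
    (I : set R) (x : R -> 'rV[R]_2) : Prop :=
  forall t : R, I t -> is_derive t 1 x (f (x t)).

Definition periodic_cycle (R : realType) (f : 'rV[R]_2 -> 'rV[R]_2) (T : R)
    (x0 : R -> 'rV[R]_2) : Prop :=
  [/\ ode_solution f setT x0,
      exists t s, x0 t <> x0 s,
      is_periodic T x0 &
      forall s, 0 < s -> s < T -> ~ is_periodic s x0].

Definition nondegenerate_cycle (R : realType) (f : 'rV[R]_2 -> 'rV[R]_2) (T : R)
    (x0 : R -> 'rV[R]_2) : Prop :=
  exists y : R -> 'rV[R]_2,
    (forall t : R, is_derive t 1 y ('d f (x0 t) (y t))) /\ ~ is_periodic T y.

(* The values at [t] of solutions of [x' = f x] that start from [xi] at time
   [t0] and live on an open interval containing [t0] and [t]. For a C1 field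
   there is at most one such value, and there is one exactly when the maximal
   solution through [(t0, xi)] reaches time [t]. *)
Definition flow_values (R : realType) (f : 'rV[R]_2 -> 'rV[R]_2) (t t0 : R)
    (xi : 'rV[R]_2) : set 'rV[R]_2 :=
  [set x | exists a b (u : R -> 'rV[R]_2),
     [/\ t0 \in `]a, b[, t \in `]a, b[, ode_solution f [set` `]a, b[] u,
         u t0 = xi & u t = x]].

Definition Omega_defined (R : realType) (f : 'rV[R]_2 -> 'rV[R]_2) (t t0 : R)
    (xi : 'rV[R]_2) : Prop :=
  flow_values f t t0 xi !=set0.

(* Only meaningful when [Omega_defined f t t0 xi]; the value is 0 otherwise. *)
Definition Omega (R : realType) (f : 'rV[R]_2 -> 'rV[R]_2) (t t0 : R)
    (xi : 'rV[R]_2) : 'rV[R]_2 :=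
  xget 0 (flow_values f t t0 xi).

Definition in_K (R : realType) (A : set 'rV[R]_2) : Prop :=
  [/\ A !=set0, compact A & @convex_set R 'rV[R]_2 A].

Definition plane_point (R : realType) (a b : R) : 'rV[R]_2 :=
  \row_j (if j == 0 then a else b).

(* [completed_algebra_gen mu] is the completion of the Borel sigma-algebra with
   respect to [mu], so "measurable" means Lebesgue measurable below. *)
Definition multi_measurable (R : realType)
    (g : R -> 'rV[R]_2 -> R -> set 'rV[R]_2) : Prop :=
  forall e, e \in `[0, 1] -> forall V : set 'rV[R]_2, open V ->
    completed_algebra_gen
      (@lebesgue_measure R \x (@lebesgue_measure R \x @lebesgue_measure R))%E
      [set p : R * (R * R) |
         g p.1 (plane_point p.2.1 p.2.2) e `&` V !=set0].

Definition Linfty_loc (R : realType) (mu : R -> R) : Prop :=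
  (forall Y : set R, measurable Y ->
     completed_algebra_gen (@lebesgue_measure R) (mu @^-1` Y)) /\
  (forall a b : R, exists C : R,
     {ae @lebesgue_measure R, forall t, t \in `[a, b] -> `|mu t| <= C}).

Definition abs_continuous (R : realType) (a b : R) (x : R -> 'rV[R]_2) : Prop :=
  forall eta : R, 0 < eta -> exists2 delta : R, 0 < delta &
    forall (n : nat) (p q : 'I_n -> R),
      (forall i, [/\ a <= p i, p i <= q i & q i <= b]) ->
      trivIset setT (fun i => [set` `]p i, q i[]) ->
      \sum_(i < n) (q i - p i) < delta ->
      \sum_(i < n) `|x (q i) - x (p i)| < eta.

Definition periodic_inclusion_solution (R : realType)
    (f : 'rV[R]_2 -> 'rV[R]_2) (g : R -> 'rV[R]_2 -> R -> set 'rV[R]_2)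
    (T e : R) (x : R -> 'rV[R]_2) : Prop :=
  [/\ is_periodic T x,
      forall a b, abs_continuous a b x &
      {ae @lebesgue_measure R, forall t, derivable x t 1 /\
         exists2 y, g t (x t) e y & derive1 x t = f (x t) + e *: y}].

(* Main.v *)
(* Let [w] solve the variational equation along [x0] with [w 0 = A1], and let
   [U v] be the solution of [x' = f x] starting from [x0 0 + v A1]. The vectors
   [x0'] and [w] stay linearly independent, so that near 0 the map
   [(D, v) |-> x_e D - U v T] is a small Lipschitz perturbation of the isomorphism
   [(D, v) |-> D x0' 0 - v w T]; the contraction principle solves the equation.
   Nondegeneracy means that [w] is not [T]-periodic, that is [w 2T <> w T]. Since
   [x_e (. + D)] starts at [U v T], Gronwall's inequality keeps it [O(e)]-close to
   [U v (T + .)] over one period, and its periodicity yields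
   [U v 2T - U v T = O(e)]. The latter difference is [v (w 2T - w T) + o(v)], hence
   [v = O(e)], and Gronwall's inequality applied to [x_e (. + D)] and [x0] gives
   the estimate. *)

Require Import Defs.
From HB Require Import structures.
From mathcomp Require Import all_boot all_order all_algebra.
From mathcomp Require Import all_classical all_reals all_analysis.
From mathcomp Require Import measurable_realfun ring lra.
Import Order.TTheory GRing.Theory Num.Theory.
Import numFieldNormedType.Exports.
Local Open Scope classical_set_scope.
Local Open Scope ring_scope.
Set Implicit Arguments.
Unset Strict Implicit.
Unset Printing Implicit Defensive.

(** * Increments of absolutely continuous functions *)

(** A perturbed solution is only absolutely continuous, so its derivative is controlled almost
    everywhere. Gronwall's inequality is therefore derived from a bound on increments that tolerates
    an exceptional set near which the function varies little: the empty set for smooth solutions, a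
    null set for perturbed ones. No integral of the perturbation is ever formed.

    Uniqueness of [(D, v)] in a square that does not depend on [e] requires estimates for pairs of
    parameters. Differentiability at 0 would not suffice, and this is why [f] and its flow are
    linearized in two-point form.

    The field [f] is only locally Lipschitz, so solutions are constructed for a bounded Lipschitz
    field that agrees with [f] on a ball around the cycle. They are identified with [Omega]
    afterwards.

    The contraction bounds [D] and [v] by a multiple of [|x_e 0 - x0 0|], which tends to 0 without
    any rate. The rate of [v] has to come from the second period, while [D] needs none: it is only a
    time shift and does not enter the final estimate. *)

Lemma is_derive1P (R : realType) (V : normedModType R) (z : R -> V) (t : R)
    (v : V) :
  is_derive t 1 z v <->
  forall k, 0 < k -> exists2 d, 0 < d & forall s, `|s - t| < d ->
    `|z s - z t - (s - t) *: v| <= k * `|s - t|.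
Proof.
split=> [[dz zv] k k0|H].
  move: dz; rewrite /derivable => /cvg_ex[l dl].
  have lv : l = v by rewrite -zv; apply/esym/cvg_lim.
  move: dl; rewrite lv => /cvgrPdist_le /(_ k k0) /nbhs_ballP[d /= d0 Hd].
  exists d => // s std; have [->|st] := eqVneq s t.
    by rewrite !subrr scale0r subrr !normr0 mulr0.
  have st0 : s - t != 0 by rewrite subr_eq0.
  have := Hd (s - t); rewrite /ball /= sub0r normrN => /(_ std st0).
  rewrite -[_%:A]/((s - t) * 1) mulr1 subrK => le.
  rewrite -[z s - z t](@scalerKV _ _ (s - t)) // -scalerBr normrZ mulrC.
  by rewrite ler_wpM2r // distrC.
have cv : h^-1 *: ((z \o shift t) (h *: (1 : R)) - z t) @[h --> 0^'] --> v.
  apply/cvgrPdist_le => k k0; have [d d0 Hd] := H _ k0.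
  apply/nbhs_ballP; exists d => // h /=; rewrite /ball /= sub0r normrN => hd h0.
  have := Hd (h + t); rewrite addrK => /(_ hd).
  rewrite -[_%:A]/(h * 1) mulr1 => le.
  rewrite -(ler_pM2l (_ : 0 < `|h|)) ?normr_gt0 // -normrZ scalerBr.
  by rewrite scalerA divff // scale1r distrC mulrC.
split; first by apply/cvg_ex; exists v.
exact/cvg_lim.
Qed.

(** What absolute continuity says near a null set [N], freed from measure theory. The intervals are
    listed from left to right, so that a family can be extended by appending one interval at its
    right end. *)
Definition small_variation (R : realType) (V : normedModType R) (z : R -> V)
    (a b : R) (N : set R) :=
  forall eta : R, 0 < eta -> exists2 U : set R, open U /\ N `<=` U &
    forall n (p q : nat -> R),
      (forall i, (i < n)%N -> [/\ a <= p i, p i <= q i, q i <= b &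
                               [set` `[p i, q i]] `<=` U]) ->
      (forall i j, (i < j)%N -> (j < n)%N -> q i <= p j) ->
      \sum_(i < n) `|z (q i) - z (p i)| <= eta.

(* Cousin's argument: on points outside [N] the derivative controls short
   increments, while intervals tagged in [N] are collected into a family whose
   total variation is small. *)
Lemma small_variation_increment_le (R : realType) (V : normedModType R)
    (z : R -> V) (phi dphi : R -> R) (a b : R) (N : set R) :
  a <= b -> small_variation z a b N ->
  {in `[a, b] &, {homo phi : s t / s <= t}} ->
  (forall t, t \in `[a, b] -> ~ N t ->
    is_derive t 1 phi (dphi t) /\
    exists2 v, is_derive t 1 z v & `|v| <= dphi t) ->
  `|z b - z a| <= phi b - phi a.
Proof.
move=> ab svz phi_nd dz.
suff main eta k : 0 < eta -> 0 < k ->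
    `|z b - z a| <= phi b - phi a + k * (b - a) + eta.
  apply/ler_addgt0Pr => e e0.
  have ba1 : 0 < b - a + 1 by rewrite ltr_wpDl// subr_ge0.
  have k0 : 0 < e / 2 / (b - a + 1) by rewrite !divr_gt0.
  apply: (le_trans (main (e / 2) _ _ k0)); first by rewrite divr_gt0.
  have : e / 2 / (b - a + 1) * (b - a) <= e / 2.
    by rewrite mulrAC ler_pdivrMr // ler_wpM2l ?divr_ge0 ?(ltW e0)// lerDl.
  by lra.
move=> eta0 k0; have [U [oU NU] HU] := svz _ eta0.
(* The estimate is known up to [s], except for the increments over a family of intervals lying in
   [U]. At [s = b] that sum is at most [eta]. *)
pose good s n (p q : nat -> R) := [/\
  forall i, (i < n)%N -> [/\ a <= p i, p i <= q i, q i <= s &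
                               [set` `[p i, q i]] `<=` U],
  forall i j, (i < j)%N -> (j < n)%N -> q i <= p j &
  `|z s - z a| <= phi s - phi a + k * (s - a) +
     \sum_(i < n) `|z (q i) - z (p i)|].
pose A := [set s | a <= s <= b /\ exists n p q, good s n p q].
have Aa : A a.
  split; first by rewrite lexx.
  exists 0%N, (fun=> 0), (fun=> 0); split=> //.
  by rewrite !subrr normr0 mulr0 big_ord0 !addr0.
have step c : a <= c <= b -> exists2 d, 0 < d & forall s s', A s ->
    c - d < s -> s <= c -> c <= s' -> s' < c + d -> s' <= b -> A s'.
  (* A step goes from some [s] left of [c] to any [s'] right of it. If [N c], the interval from [s]
     to [s'] lies in [U] and joins the family; otherwise the derivatives at [c] compare the two
     increments and the family stays as it is. *)
  move=> cab; have [Nc|nNc] := pselect (N c).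
    have /nbhs_ballP[d /= d0 dU] : nbhs c U by apply: open_nbhs_nbhs; split=> //; exact: NU.
    exists d => // s s' [/andP[as_ sb] [n [p [q [g1 g2 g3]]]]] cds sc cs' s'cd s'b.
    have ss' : s <= s' by exact: le_trans cs'.
    split; first by rewrite s'b andbT (le_trans as_).
    exists n.+1, (fun i => if i == n then s else p i),
      (fun i => if i == n then s' else q i); split.
    - move=> i; rewrite ltnS; case: eqVneq => [-> _|ne ilen].
        split=> // x /=; rewrite in_itv /= => /andP[sx xs']; apply: dU.
        by rewrite /ball /= ltr_norml; apply/andP; split; lra.
      have /g1[h1 h2 h3 h4] : (i < n)%N by rewrite ltn_neqAle ne.
      by split=> //; exact: le_trans ss'.
    - move=> i j ij; rewrite ltnS => jn.
      have iln : (i < n)%N by exact: leq_trans jn.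
      rewrite (ltn_eqF iln); case: eqVneq => [_|ne].
        by have [] := g1 _ iln.
      by apply: g2 => //; rewrite ltn_neqAle ne.
    - rewrite big_ord_recr /= eqxx.
      have -> : \sum_(i < n) `|z (if i == n :> nat then s' else q i) -
          z (if i == n :> nat then s else p i)| = \sum_(i < n) `|z (q i) - z (p i)|.
        by apply: eq_bigr => i _; rewrite ltn_eqF.
      have -> : z s' - z a = (z s' - z s) + (z s - z a) by rewrite addrA subrK.
      apply: (le_trans (ler_normD _ _)).
      have ps : phi s <= phi s'.
        by apply: phi_nd => //; rewrite in_itv /= ?as_ ?sb ?s'b ?(le_trans as_ ss').
      have ks : k * (s - a) <= k * (s' - a) by rewrite ler_wpM2l ?(ltW k0)// lerD2r.
      by lra.
  have cI : c \in `[a, b] by rewrite in_itv.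
  have [dp [v dv vp]] := dz c cI nNc.
  (* Half of the slack [k] pays for the linearization of [z], the other half for that of [phi]. *)
  have k2 : 0 < k / 2 by rewrite divr_gt0.
  have /is_derive1P/(_ _ k2)[d1 d10 H1] := dp.
  have /is_derive1P/(_ _ k2)[d2 d20 H2] := dv.
  exists (Num.min d1 d2); first by rewrite lt_min d10.
  move=> s s' [/andP[as_ sb] [n [p [q [g1 g2 g3]]]]] cds sc cs' s'cd s'b.
  have ss' : s <= s' by exact: le_trans cs'.
  split; first by rewrite s'b andbT (le_trans as_).
  exists n, p, q; split=> //.
    by move=> i /g1[h1 h2 h3 h4]; split=> //; exact: le_trans ss'.
  have near_c r : `|r - c| < Num.min d1 d2 ->
      `|z r - z c - (r - c) *: v| <= k / 2 * `|r - c| /\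
      `|phi r - phi c - (r - c) * dphi c| <= k / 2 * `|r - c|.
    by rewrite lt_min => /andP[r1 r2]; split; [exact: H2|exact: H1].
  have [zs ps] : `|z s - z c - (s - c) *: v| <= k / 2 * `|s - c| /\
      `|phi s - phi c - (s - c) * dphi c| <= k / 2 * `|s - c|.
    by apply: near_c; rewrite ltr_norml; apply/andP; split; lra.
  have [zs' ps'] : `|z s' - z c - (s' - c) *: v| <= k / 2 * `|s' - c| /\
      `|phi s' - phi c - (s' - c) * dphi c| <= k / 2 * `|s' - c|.
    by apply: near_c; rewrite ltr_norml; apply/andP; split; lra.
  have e1 : `|z s' - z s| <= phi s' - phi s + k * (s' - s).
    have -> : z s' - z s = (z s' - z c - (s' - c) *: v)
        - (z s - z c - (s - c) *: v) + (s' - s) *: v.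
      have -> : (s' - s) *: v = (s' - c) *: v - (s - c) *: v.
        by rewrite -scalerBl; congr (_ *: _); ring.
      by rewrite opprB [RHS]addrAC subrKA subrKA opprB subrKA.
    apply: (le_trans (ler_normD _ _)); rewrite normrZ.
    apply: (le_trans (lerD (ler_normB _ _) (lexx _))).
    rewrite (ler0_norm (_ : s - c <= 0)) ?subr_le0 // in zs ps.
    rewrite (ger0_norm (_ : 0 <= s' - c)) ?subr_ge0 // in zs' ps'.
    rewrite (ger0_norm (_ : 0 <= s' - s)) ?subr_ge0 //.
    have : (s' - s) * `|v| <= (s' - s) * dphi c by rewrite ler_wpM2l // subr_ge0.
    move: ps ps'; rewrite !ler_norml => /andP[_ ps] /andP[ps' _].
    by lra.
  have -> : z s' - z a = (z s' - z s) + (z s - z a) by rewrite addrA subrK.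
  by apply: (le_trans (ler_normD _ _)); lra.
have supA : has_sup A.
  by split; [exists a|exists b => s [/andP[]]].
pose c := sup A.
have ca : a <= c by apply: ub_le_sup => //; exact: supA.2.
have cb : c <= b by apply: ge_sup; [exists a|move=> s [/andP[]]].
have [d d0 Hd] : exists2 d, 0 < d & forall s s', A s ->
    c - d < s -> s <= c -> c <= s' -> s' < c + d -> s' <= b -> A s'.
  by apply: step; rewrite ca.
have [s As cds] := sup_adherent d0 supA.
have sc : s <= c by apply: ub_le_sup => //; exact: supA.2.
have cbE : c = b.
  apply/eqP; rewrite eq_le cb leNgt; apply/negP => cltb.
  pose s' := Num.min b (c + d / 2).
  have cs' : c < s' by rewrite lt_min cltb; lra.
  have : A s'.
    apply: (Hd s) => //; first exact: ltW.
      by rewrite gt_min; apply/orP; right; lra.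
    by rewrite ge_min lexx.
  by move=> /(ub_le_sup supA.2); rewrite leNgt cs'.
have [_ [n [p [q [g1 g2 g3]]]]] : A b.
  by apply: (Hd s) => //; rewrite cbE ?lexx // ltrDl.
apply: (le_trans g3); rewrite lerD2l; exact: HU.
Qed.

(** With [U] empty, no interval fits, since [[p i, q i]] contains [p i]; only the empty family
    remains. *)
Lemma small_variation0 (R : realType) (V : normedModType R) (z : R -> V)
    (a b : R) : small_variation z a b set0.
Proof.
move=> eta eta0; exists set0; first by split; [exact: open0|].
case=> [|n] p q Hpq _; first by rewrite big_ord0 ltW.
have [_ pq _ /(_ (p 0%N))] := Hpq 0%N isT.
by rewrite /= in_itv /= lexx pq => /(_ isT).
Qed.

Lemma small_variation_itv (R : realType) (V : normedModType R) (z : R -> V)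
    (a b b' : R) (N : set R) :
  b' <= b -> small_variation z a b N -> small_variation z a b' N.
Proof.
move=> b'b svz eta eta0; have [U oU HU] := svz _ eta0; exists U => // n p q H1 H2.
apply: HU => // i /H1[? ? ? ?]; split=> //; exact: le_trans b'b.
Qed.

(** By outer regularity [N] has an open neighbourhood of measure less than [delta]. Disjoint
    intervals inside it have total length below [delta], and absolute continuity applies to them. *)
Lemma abs_continuous_small_variation (R : realType) (z : R -> 'rV[R]_2)
    (a b : R) (N : set R) :
  abs_continuous a b z -> (@lebesgue_measure R).-negligible N ->
  small_variation z a b N.
Proof.
move=> acz [A [mA A0 NA]] eta eta0.
have [delta delta0 Hd] := acz _ eta0.
have [U [oU AU UA]] : exists U : set R, [/\ open U, A `<=` U &
    (lebesgue_measure (U `\` A) < delta%:E)%E].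
  apply: lebesgue_regularity_outer => //.
  by rewrite [X in (X < _)%E]A0 ltry.
have mU : measurable U by exact: open_measurable.
have Ud : (lebesgue_measure U < delta%:E)%E.
  rewrite (measureDI lebesgue_measure mU mA).
  rewrite [X in (_ + X < _)%E](_ : _ = 0%E) ?adde0 //.
  apply: (@subset_measure0 _ _ _ lebesgue_measure _ A) => //.
    exact: measurableI.
exists U; first by split=> // t /NA /AU.
move=> n p q H1 H2; apply: ltW.
have tI : trivIset [set: 'I_n] (fun k : 'I_n => [set` `]p k, q k[] : set R).
  apply/trivIsetP => i j _ _ ij; apply/seteqP; split=> // t [] /=.
  rewrite !in_itv /= => /andP[pi ti] /andP[pj tj].
  have [ltij|ltji|eij] := ltngtP i j; last by move/val_inj: eij ij => ->; rewrite eqxx.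
    by have := H2 _ _ ltij (ltn_ord j); rewrite leNgt (lt_trans pj ti).
  by have := H2 _ _ ltji (ltn_ord i); rewrite leNgt (lt_trans pi tj).
have := Hd n (fun i => p i) (fun i => q i); apply.
- by move=> i; have [] := H1 i (ltn_ord i).
- exact: tI.
rewrite -lte_fin; apply: le_lt_trans Ud.
have mI (k : 'I_n) : measurable ([set` `]p k, q k[] : set R) by exact: measurable_itv.
have mB : measurable (\big[setU/set0]_(k < n) ([set` `]p k, q k[] : set R)).
  exact: bigsetU_measurable.
have -> : (\sum_(i < n) (q i - p i))%:E = lebesgue_measure
    (\big[setU/set0]_(k < n) ([set` `]p k, q k[] : set R)).
  rewrite (measure_semi_additive_ord lebesgue_measure) // -sumEFin.
  apply: eq_bigr => i _.
  rewrite /= lebesgue_measure_itv /= lte_fin.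
  have [_ pq _ _] := H1 i (ltn_ord i).
  case: ltP => // qp; congr (_%:E); apply/eqP; rewrite subr_eq0 eq_le qp pq //.
apply: le_measure; rewrite ?inE //.
move=> t; rewrite -bigcup_seq => -[i _ /= ti].
have [_ _ _ ] := H1 i (ltn_ord i); apply => /=.
by move: ti; rewrite !in_itv /= => /andP[/ltW -> /ltW ->].
Qed.

Lemma abs_continuousB (R : realType) (a b : R) (x y : R -> 'rV[R]_2) :
  abs_continuous a b x -> abs_continuous a b y ->
  abs_continuous a b (fun t => x t - y t).
Proof.
move=> acx acy eta eta0; have e2 : 0 < eta / 2 by rewrite divr_gt0.
have [d1 d10 H1] := acx _ e2; have [d2 d20 H2] := acy _ e2.
exists (Num.min d1 d2); first by rewrite lt_min d10.
move=> n p q pq tpq; rewrite lt_min => /andP[/(H1 _ _ _ pq tpq) S1 /(H2 _ _ _ pq tpq) S2].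
rewrite [eta](_ : _ = eta / 2 + eta / 2); last by field.
apply: le_lt_trans (ltrD S1 S2); rewrite -big_split /=; apply: ler_sum => i _.
rewrite (_ : x _ - y _ - _ = x (q i) - x (p i) - (y (q i) - y (p i))).
  exact: ler_normB.
by rewrite !opprB (AC (2*2) ((1*4)*(3*2))).
Qed.

Lemma lipschitz_abs_continuous (R : realType) (a b k : R) (x : R -> 'rV[R]_2) :
  0 < k -> (forall s t, a <= s -> s <= t -> t <= b -> `|x t - x s| <= k * (t - s)) ->
  abs_continuous a b x.
Proof.
move=> k0 xk eta eta0; exists (eta / k); first by rewrite divr_gt0.
move=> n p q pq _; rewrite ltr_pdivlMr // mulrC; apply: le_lt_trans.
by rewrite mulr_sumr; apply: ler_sum => i _; have [] := pq i; exact: xk.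
Qed.

Lemma abs_continuous_continuous (R : realType) (x : R -> 'rV[R]_2) :
  (forall a b, abs_continuous a b x) -> continuous x.
Proof.
move=> acx t; apply/cvgrPdist_lt => e e0.
have [d d0 Hd] := acx (t - 1) (t + 1) _ e0.
have triv (p q : 'I_1 -> R) : trivIset setT (fun i => [set` `]p i, q i[]).
  by apply/trivIsetP => i j _ _; rewrite !ord1 eqxx.
have inc r s : t - 1 <= r -> r <= s -> s <= t + 1 -> s - r < d -> `|x s - x r| < e.
  move=> tr rs st sr.
  have := Hd 1%N (fun=> r) (fun=> s); rewrite !big_ord_recl !big_ord0 !addr0.
  by apply=> //; exact: triv.
apply/nbhs_ballP; exists (Num.min d 1) => /=; first by rewrite lt_min d0 ltr01.
move=> s; rewrite /ball /= lt_min !ltr_norml => /andP[/andP[h1 h2] /andP[h3 h4]].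
have [st|ts] := leP s t; first by apply: inc => //; lra.
by rewrite distrC; apply: inc; lra.
Qed.

(** Weighted maximum argument: let [m] be the maximum of [|z s| / E s], attained at [c]. Since
    [E' = 2 L E], the growth bound [L m E + k] has the antiderivative [m / 2 * E + k s], so half of
    [|z c| = m E c] is absorbed. The price is the factors 2 in the conclusion. *)
Lemma gronwall (R : realType) (V : normedModType R) (z : R -> V)
    (a b L k : R) (N : set R) :
  0 <= L -> 0 <= k -> {within `[a, b], continuous z} -> small_variation z a b N ->
  (forall t, t \in `[a, b] -> ~ N t ->
     exists2 v, is_derive t 1 z v & `|v| <= L * `|z t| + k) ->
  forall t, t \in `[a, b] ->
    `|z t| <= 2 * expR (2 * L * (t - a)) * (`|z a| + k * (t - a)).
Proof.
move=> L0 k0 cz svz dz t; rewrite in_itv /= => /andP[at_ tb].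
pose E s := expR (2 * L * (s - a)).
have E0 s : 0 < E s by exact: expR_gt0.
have dE (s : R) : is_derive s (1 : R) E (2 * L * E s).
  rewrite /E; apply: is_derive_eq.
  by rewrite /GRing.scale /=; ring.
have cE : continuous E.
  by move=> s; apply: differentiable_continuous; apply/derivable1_diffP; case: (dE s).
pose h s := `|z s| / E s.
have ch : {within `[a, t], continuous h}.
  move=> s; apply: cvgM.
    apply: cvg_norm; apply: (continuous_subspaceW _ cz).
    by move=> r /=; rewrite !in_itv /= => /andP[-> /le_trans]; apply.
  by apply: cvgV; [rewrite gt_eqF|exact: (continuous_subspaceT cE)].
have [c cI hc] : exists2 c, c \in `[a, t] & forall s, s \in `[a, t] -> h s <= h c.
  exact: EVT_max.
set m := h c in hc; have m0 : 0 <= m by rewrite divr_ge0 // ltW.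
move: (cI); rewrite in_itv /= => /andP[ac ct].
have zE s : s \in `[a, t] -> `|z s| <= m * E s.
  by move=> /hc; rewrite ler_pdivrMr.
have zc : `|z c| = m * E c by rewrite divfK // gt_eqF.
have E_nd s r : s <= r -> E s <= E r.
  move=> sr; rewrite ler_expR; apply: ler_wpM2l; last by rewrite lerD2r.
  by rewrite mulr_ge0.
have inc : `|z c - z a| <= (m / 2 * E c + k * c) - (m / 2 * E a + k * a).
  apply: (@small_variation_increment_le _ _ z (fun s => m / 2 * E s + k * s)
    (fun s => L * (m * E s) + k) a c N) => //.
  - by apply: small_variation_itv svz; exact: le_trans tb.
  - move=> s r _ _ sr; apply: lerD; apply: ler_wpM2l => //; last exact: E_nd.
    by rewrite divr_ge0.
  - move=> s; rewrite in_itv /= => /andP[as_ sc] Ns; split.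
      by apply: is_derive_eq; rewrite /GRing.scale /=; field.
    have [|v dv vb] := dz s _ Ns; first by rewrite in_itv /= as_ (le_trans sc) // (le_trans ct).
    exists v => //; apply: (le_trans vb); rewrite lerD2r ler_wpM2l //.
    by apply: zE; rewrite in_itv /= as_ (le_trans sc).
have Ea : E a = 1 by rewrite /E subrr mulr0 expR0.
have : `|z c| <= `|z a| + `|z c - z a|.
  by rewrite -[in leLHS](subrK (z a) (z c)) addrC ler_normD.
rewrite zc => mE.
have mEc : m <= m * E c by rewrite ler_peMr // -Ea E_nd.
have kc : k * (c - a) <= k * (t - a) by rewrite ler_wpM2l // lerD2r.
have mle : m <= 2 * (`|z a| + k * (t - a)) by move: inc; rewrite Ea; lra.
apply: (le_trans (zE t _)); first by rewrite in_itv /= at_ lexx.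
by rewrite -/(E t) [leRHS]mulrAC ler_wpM2r // ltW.
Qed.

(** * Continuously differentiable vector fields *)

Lemma mean_value_le (R : realType) (V : normedModType R) (z dz : R -> V)
    (a b M : R) : a <= b ->
  (forall t, t \in `[a, b] -> is_derive t 1 z (dz t) /\ `|dz t| <= M) ->
  `|z b - z a| <= M * (b - a).
Proof.
move=> ab H.
have M0 : 0 <= M.
  by have [|_] := H a; [rewrite in_itv /= lexx|exact: le_trans].
rewrite mulrBr.
apply: (@small_variation_increment_le _ _ z (fun t => M * t) (fun=> M) a b set0) => //.
- exact: small_variation0.
- by move=> s t _ _ st; exact: ler_wpM2l.
move=> t /H[dt dM] _; split; last by exists (dz t).
by apply: is_derive_eq; rewrite /GRing.scale /=; ring.
Qed.

Lemma mulmx_norm_le (R : realType) (n : nat) (h : 'rV[R]_n) (J : 'M[R]_n) :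
  `|h *m J| <= n%:R * `|h| * `|J|.
Proof.
have ent (m p : nat) (A : 'M[R]_(m, p)) i j : `|A i j| <= `|A|.
  rewrite [leRHS]/Num.norm /= mx_normrE.
  exact: (le_bigmax _ (fun ij : 'I_m * 'I_p => `|A ij.1 ij.2|) (i, j)).
rewrite [leLHS]/Num.norm /= mx_normrE; apply/bigmax_leP; split=> [|i _].
  by rewrite !mulr_ge0.
rewrite mxE; apply: le_trans (ler_norm_sum _ _ _) _.
apply: (@le_trans _ _ (\sum_(k < n) `|h| * `|J|)).
  by apply: ler_sum => k _; rewrite normrM ler_pM.
by rewrite sumr_const card_ord -[leLHS]mulr_natl mulrA.
Qed.

Lemma closed_norm_ball_compact (R : realType) (n : nat) (K : R) :
  compact [set c : 'rV[R]_n | `|c| <= K].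
Proof.
apply: bounded_closed_compact.
  exists K; split; first by rewrite num_real.
  by move=> M KM c /= cK; rewrite (le_trans cK) // ltW.
apply: (@closed_comp _ _ (fun c : 'rV[R]_n => `|c|) [set r | r <= K]).
  by move=> c _; exact: norm_continuous.
exact: closed_le.
Qed.

Lemma is_derive_scalel (R : realType) (V : normedModType R) (h : V) (t : R) :
  is_derive t 1 (fun s : R => s *: h) h.
Proof.
apply/is_derive1P => k k0; exists 1 => // s _.
by rewrite -scalerBl subrr normr0 mulr_ge0 // ltW.
Qed.

Lemma is_derive1B (R : realType) (V : normedModType R) (x y : R -> V)
    (dx dy : V) (t : R) : is_derive t 1 x dx -> is_derive t 1 y dy ->
  is_derive t 1 (fun s => x s - y s) (dx - dy).
Proof. exact: is_deriveB. Qed.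

Lemma is_derive_segment (R : realType) (V W : normedModType R) (f : V -> W)
    (a h : V) (t : R) : differentiable f (a + t *: h) ->
  is_derive t 1 (fun s => f (a + s *: h)) ('d f (a + t *: h) h).
Proof.
move=> df; have dl : is_diff t (fun s : R => a + s *: h) ( *:%R^~ h).
  apply: is_diff_eq; apply/funext => s /=.
  by rewrite add0r.
have dfl : is_diff t (f \o (fun s : R => a + s *: h))
    ('d f (a + t *: h) \o ( *:%R^~ h)).
  apply: is_diff_comp; exact: differentiableP.
have [dfl1 dfl2] := dfl.
split; first exact/derivable1_diffP.
by rewrite deriveE // dfl2 /= scale1r.
Qed.

Lemma diff_jacobian (R : realType) (f : 'rV[R]_2 -> 'rV[R]_2) (c h : 'rV[R]_2) :
  differentiable f c -> 'd f c h = h *m jacobian f c.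
Proof. by move=> df; rewrite -deriveE // deriveEjacobian. Qed.

(** Compactness makes [delta] uniform in the centre [c]; the point [z] itself may lie outside the
    ball. *)
Lemma continuous_unif_on_ball (R : realType) (n : nat) (W : normedModType R)
    (G : 'rV[R]_n -> W) (K eta : R) : continuous G -> 0 < eta ->
  exists2 delta, 0 < delta & forall c, `|c| <= K ->
    forall z, `|z - c| <= delta -> `|G z - G c| <= eta.
Proof.
move=> cG eta0.
have /compact_near_coveringP /(_ R (0^'+) (fun d c => forall z, `|z - c| <= d ->
    `|G z - G c| <= eta) _) H := @closed_norm_ball_compact R n K.
have {}H : \forall d \near 0^'+, forall c, `|c| <= K -> forall z,
    `|z - c| <= d -> `|G z - G c| <= eta.
  apply: H => c cK.
  have /cvgrPdist_le /(_ (eta / 2)) := cG c.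
  rewrite divr_gt0 // => /(_ isT) /nbhs_ballP[e /= e0 He].
  have e2 : 0 < e / 2 by rewrite divr_gt0.
  exists (ball c (e / 2), [set d | d < e / 2]).
    by split; [exact: nbhsx_ballx|exact: nbhs_right_lt].
  move=> [c' d] /= [cc' de] z zc'.
  have cb' : ball c e c' by apply: le_ball cc'; lra.
  have cz : ball c e z.
    rewrite -ball_normE /= in cc' *.
    rewrite (_ : c - z = (c - c') - (z - c')); last by rewrite opprB addrA subrK.
    by apply: (le_lt_trans (ler_normB _ _)); lra.
  have h1 := He _ cb'; have h2 := He _ cz.
  rewrite (_ : _ - _ = (G c - G c') - (G c - G z)).
    by apply: (le_trans (ler_normB _ _)); lra.
  by rewrite opprB [RHS]addrC subrKA.
have [d [d0 Hd]] := filter_ex (filterI (nbhs_right_gt 0) H).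
by exists d.
Qed.

(** Mean value estimate on the segment from [a] to [b] for [f] minus its linearization at [c], whose
    derivative is small by uniform continuity of the jacobian. A single [delta] serves all [c] of
    the ball, hence all points of the cycle. *)
Lemma C1_strongly_differentiable (R : realType) (f : 'rV[R]_2 -> 'rV[R]_2)
    (K eta : R) : C1_map f -> 0 < eta ->
  exists2 delta, 0 < delta & forall c a b, `|c| <= K ->
    `|a - c| <= delta -> `|b - c| <= delta ->
    `|f b - f a - 'd f c (b - a)| <= eta * `|b - a|.
Proof.
move=> [df cJ] eta0.
have [delta delta0 HJ] : exists2 delta, 0 < delta & forall c, `|c| <= K ->
    forall z, `|z - c| <= delta -> `|jacobian f z - jacobian f c| <= eta / 2.
  by apply: continuous_unif_on_ball => //; rewrite divr_gt0.
exists delta => // c a b cK ac bc.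
have := @mean_value_le _ _ (fun t => f (a + t *: (b - a)) - t *: 'd f c (b - a))
  (fun t => 'd f (a + t *: (b - a)) (b - a) - 'd f c (b - a)) 0 1
  (eta * `|b - a|) ler01.
rewrite !scale0r !scale1r !addr0 !subr0 mulr1 [a + _]addrC subrK.
rewrite addrAC; apply => t; rewrite in_itv /= => /andP[t0 t1]; split.
  have dt : is_derive t (1 : R) (fun t : R => t *: 'd f c (b - a)) ('d f c (b - a)).
    exact: is_derive_scalel.
  exact: is_derive1B (is_derive_segment (df _)) dt.
have -> : 'd f (a + t *: (b - a)) (b - a) - 'd f c (b - a) =
    (b - a) *m (jacobian f (a + t *: (b - a)) - jacobian f c).
  by rewrite mulmxBr; congr (_ - _); exact: diff_jacobian.
apply: (le_trans (mulmx_norm_le _ _)).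
have -> : eta * `|b - a| = 2 * `|b - a| * (eta / 2) by field.
apply: ler_wpM2l; first by rewrite mulr_ge0.
apply: HJ => //.
rewrite (_ : _ - c = (1 - t) *: (a - c) + t *: (b - c)).
  apply: (le_trans (ler_normD _ _)); rewrite !normrZ !ger0_norm ?subr_ge0 //.
  rewrite [leRHS](_ : _ = (1 - t) * delta + t * delta); last by ring.
  by apply: lerD; apply: ler_wpM2l; rewrite ?subr_ge0.
rewrite scalerBl scale1r -[RHS]addrA [X in _ = _ + X]addrC -scalerBr opprB subrKA.
exact: addrAC.
Qed.

Lemma C1_lipschitz_on_ball (R : realType) (f : 'rV[R]_2 -> 'rV[R]_2) (K : R) :
  C1_map f -> exists2 L, 0 < L &
    (forall c h, `|c| <= K -> `|'d f c h| <= L * `|h|) /\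
    (forall a b, `|a| <= K -> `|b| <= K -> `|f b - f a| <= L * `|b - a|).
Proof.
move=> [df cJ].
have [B B0 HB] : exists2 B, 0 < B & forall c, `|c| <= K -> `|jacobian f c| <= B.
  have : bounded_set (jacobian f @` [set c | `|c| <= K]).
    apply: compact_bounded; apply: continuous_compact.
      by apply: continuous_subspaceT => ?; exact: cJ.
    exact: closed_norm_ball_compact.
  move=> [M [_ HM]]; exists (`|M| + 1); first by rewrite ltr_wpDl.
  move=> c cK; apply: HM; last by exists c.
  by rewrite (le_lt_trans (ler_norm M)) // ltrDl.
have dB c h : `|c| <= K -> `|'d f c h| <= 2 * B * `|h|.
  move=> cK; rewrite (diff_jacobian _ (df _)); apply: (le_trans (mulmx_norm_le _ _)).
  by rewrite mulrAC ler_wpM2r // ler_wpM2l // HB.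
exists (2 * B); first by rewrite mulr_gt0.
split=> // a b aK bK.
have := @mean_value_le _ _ (fun t => f (a + t *: (b - a)))
  (fun t => 'd f (a + t *: (b - a)) (b - a)) 0 1 (2 * B * `|b - a|) ler01.
rewrite scale0r scale1r addr0 subr0 mulr1 [a + _]addrC subrK.
apply => t; rewrite in_itv /= => /andP[t0 t1]; split.
  exact: is_derive_segment.
apply: dB; rewrite (_ : _ + _ = (1 - t) *: a + t *: b).
  apply: (le_trans (ler_normD _ _)); rewrite !normrZ !ger0_norm ?subr_ge0 //.
  rewrite [leRHS](_ : _ = (1 - t) * K + t * K); last by ring.
  by apply: lerD; apply: ler_wpM2l; rewrite ?subr_ge0.
rewrite scalerBl scale1r scalerBr addrA; exact: addrAC.
Qed.

(** * Existence of solutions for bounded Lipschitz vector fields *)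

(* The library equips matrices with a norm and with completeness, but not with
   the join of the two structures. *)
HB.instance Definition _ (R : realType) (m n : nat) := Complete.on 'M[R]_(m, n).

Lemma norm_lipschitz_continuous (R : realType) (V W : normedModType R)
    (F : V -> W) (L : R) : 0 < L ->
  (forall a b, `|F b - F a| <= L * `|b - a|) -> continuous F.
Proof.
move=> L0 FL a; apply/cvgrPdist_lt => e e0; apply/nbhs_ballP.
exists (e / L); first by rewrite /= divr_gt0.
move=> b; rewrite -ball_normE /= ltr_pdivlMr // mulrC => ab.
exact: le_lt_trans (FL _ _) ab.
Qed.

Lemma is_derive1_continuous (R : realType) (V : normedModType R)
    (u du : R -> V) : (forall t : R, is_derive t 1 u (du t)) -> continuous u.
Proof.
move=> H t; apply: differentiable_continuous; apply/derivable1_diffP.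
by case: (H t).
Qed.

Lemma is_derive1_cst (R : realType) (V : normedModType R) (c : V) (t : R) :
  is_derive t 1 (fun=> c) (0 : V).
Proof. exact: is_derive_cst. Qed.

Lemma continuous_antiderivative_gtN1 (R : realType) (g : R -> R) :
  continuous g -> exists G : R -> R, forall t : R, -1 < t -> is_derive t 1 G (g t).
Proof.
move=> cg; exists (fun t => \int[lebesgue_measure]_(s in `[-1, t]) g s) => t t1.
have [||//||d1 d2] := @continuous_FTC1_closed R g (-1) t (t + 1).
- by rewrite ltrDl.
- apply: continuous_compact_integrable; first exact: segment_compact.
  exact: continuous_subspaceT.
- exact: cg.
by split=> //; rewrite -derive1E.
Qed.

Lemma is_derive1_opp (R : realType) (V : normedModType R) (z : R -> V)
    (v : V) (t : R) :
  is_derive (- t) 1 z v -> is_derive t 1 (fun s => z (- s)) (- v).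
Proof.
move=> /is_derive1P H; apply/is_derive1P => k /H[d d0 Hd]; exists d => // s sd.
have E : `|- s - - t| = `|s - t| by rewrite -opprD normrN.
have := Hd (- s); rewrite E => /(_ sd).
by rewrite -opprD scaleNr scalerN.
Qed.

(** An antiderivative on [t > -1] and a reflected one on [t < 1] overlap around 0. They differ there
    by a constant, so they can be glued at 0 without losing differentiability. *)
Lemma continuous_antiderivative (R : realType) (g : R -> R) : continuous g ->
  exists2 G : R -> R, G 0 = 0 & forall t : R, is_derive t 1 G (g t).
Proof.
move=> cg; have [P dP] := continuous_antiderivative_gtN1 cg.
have [|Q dQ] := @continuous_antiderivative_gtN1 R (fun t => - g (- t)).
  move=> t; apply: cvgN.
  by apply: (continuous_comp (opp_continuous t)); exact: cg.
have dQN (t : R) : t < 1 -> is_derive t 1 (fun s => Q (- s)) (g t).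
  move=> t1; rewrite -[g t]opprK -[in g t](opprK t); apply: is_derive1_opp.
  by apply: dQ; rewrite ltrN2.
have PQ (t : R) : -1 < t -> t < 1 -> P t - P 0 = Q (- t) - Q 0.
  move=> t1 t2.
  suff cst a b : -1 < a -> a <= b -> b < 1 -> P b - Q (- b) = P a - Q (- a).
    have : P t - Q (- t) = P 0 - Q (- 0).
      by have [t0|t0] := leP 0 t; [apply: cst; lra|apply/esym/cst; lra].
    by rewrite oppr0; lra.
  move=> a1 ab b1; apply/eqP; rewrite -subr_eq0 -normr_le0.
  have -> : 0 = 0 * (b - a) by rewrite mul0r.
  apply: (@mean_value_le _ _ (fun s => P s - Q (- s)) (fun=> 0)) => // s.
  rewrite in_itv /= => /andP[as_ sb]; rewrite normr0; split=> //.
  rewrite -(subrr (g s)); apply: is_derive1B; first by apply: dP; lra.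
  by apply: dQN; lra.
exists (fun t => if 0 <= t then P t - P 0 else Q (- t) - Q 0).
  by rewrite lexx subrr.
move=> t; have [t0|t0] := leP 0 t.
  apply: (@near_eq_is_derive _ _ _ (fun s => P s - P 0)).
    have : \forall s \near t, -1 < s by apply: lt_nbhsr; lra.
    apply: filterS => s s1; case: ifPn => // s0; apply: PQ => //.
    by move: s0; rewrite -ltNge; lra.
  have dPt : is_derive t 1 P (g t) by apply: dP; lra.
  by rewrite -[g t]subr0; exact: is_derive1B dPt (is_derive1_cst _ _).
apply: (@near_eq_is_derive _ _ _ (fun s => Q (- s) - Q 0)).
  have : \forall s \near t, s < 0 by exact: lt_nbhsl.
  by apply: filterS => s s0; rewrite leNgt s0.
have dQt : is_derive t 1 (fun s => Q (- s)) (g t) by apply: dQN; lra.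
by rewrite -[g t]subr0; exact: is_derive1B dQt (is_derive1_cst _ _).
Qed.

Lemma continuous_antiderivative_rV (R : realType) (n : nat) (g : R -> 'rV[R]_n) :
  continuous g ->
  exists2 G : R -> 'rV[R]_n, G 0 = 0 & forall t : R, is_derive t 1 G (g t).
Proof.
move=> cg.
have /choice[G HG] : forall j, exists G : R -> R,
    G 0 = 0 /\ forall t : R, is_derive t 1 G (g t ord0 j).
  move=> j; have [|G G0 dG] := @continuous_antiderivative R (fun t => g t ord0 j).
    move=> t; apply: (@continuous_comp _ _ _ g (fun M : 'rV[R]_n => M ord0 j) t (cg t)).
    exact: coord_continuous.
  by exists G.
have E i j : (fun t => (\row_j G j t : 'rV[R]_n) i j) = G j.
  by apply/funext => t; rewrite mxE.
exists (fun t => \row_j G j t).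
  by apply/rowP => j; rewrite !mxE; case: (HG j).
move=> t; have dG : derivable (fun t => \row_j G j t : 'rV[R]_n) t 1.
  by apply/derivable_mxP => i j; rewrite E; case: (HG j) => _ /(_ t)[].
split=> //; rewrite derive_mx //; apply/matrixP => i j.
by rewrite mxE E ord1; case: (HG j) => _ /(_ t)[_ ->].
Qed.

Lemma mean_value_abs_le (R : realType) (V : normedModType R) (z dz : R -> V)
    (s t M : R) :
  (forall r, `|r - t| <= `|s - t| -> is_derive r 1 z (dz r) /\ `|dz r| <= M) ->
  `|z s - z t| <= M * `|s - t|.
Proof.
move=> H; have [ts|/ltW st] := leP t s.
  rewrite ger0_norm ?subr_ge0 //; apply: mean_value_le => // r.
  rewrite in_itv /= => /andP[tr rs]; apply: H.
  by rewrite !ger0_norm ?subr_ge0 // lerD2r.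
rewrite distrC [`|s - t|]distrC ger0_norm ?subr_ge0 //.
apply: mean_value_le => // r; rewrite in_itv /= => /andP[tr rs]; apply: H.
by rewrite distrC [leRHS]distrC !ger0_norm ?subr_ge0 // lerB.
Qed.

(** Integration gains a factor [1 / K] in the norm weighted by [expR (K * |t|)]; this makes the
    Picard operator a contraction on the whole line. *)
Lemma exp_increment_le (R : realType) (V : normedModType R) (z dz : R -> V)
    (D K : R) : 0 < K -> 0 <= D -> z 0 = 0 ->
  (forall t : R, is_derive t 1 z (dz t)) ->
  (forall t, `|dz t| <= D * expR (K * `|t|)) ->
  forall t, `|z t| <= D / K * expR (K * `|t|).
Proof.
move=> K0 D0; move: z dz.
suff H (z dz : R -> V) : z 0 = 0 -> (forall t : R, is_derive t 1 z (dz t)) ->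
    (forall t, `|dz t| <= D * expR (K * `|t|)) ->
    forall t, 0 <= t -> `|z t| <= D / K * expR (K * t).
  move=> z dz z0 zd dzb t; have [t0|/ltW t0] := leP 0 t.
    by rewrite [`|t|]ger0_norm //; exact: H z0 zd dzb t t0.
  rewrite [`|t|]ler0_norm //.
  suff: `|z (- - t)| <= D / K * expR (K * - t) by rewrite opprK.
  apply: (H (fun s => z (- s)) (fun s => - dz (- s)) _ _ _ (- t)).
  - by rewrite oppr0.
  - by move=> s; exact: is_derive1_opp.
  - by move=> s; rewrite normrN (le_trans (dzb _)) // normrN.
  - by rewrite oppr_ge0.
move=> z0 zd dzb t t0.
have : `|z t - z 0| <= D / K * expR (K * t) - D / K * expR (K * 0).
  apply: (@small_variation_increment_le _ _ z (fun s => D / K * expR (K * s))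
    (fun s => D * expR (K * s)) 0 t set0) => //.
  - exact: small_variation0.
  - move=> r s _ _ rs; rewrite ler_wpM2l ?divr_ge0 ?(ltW K0) //.
    by rewrite ler_expR ler_wpM2l // ltW.
  move=> s; rewrite in_itv /= => /andP[s0 _] _; split.
    apply: is_derive_eq; rewrite /GRing.scale /=.
    by field; rewrite gt_eqF.
  by exists (dz s) => //; rewrite (le_trans (dzb s)) // ger0_norm.
rewrite z0 subr0 => /le_trans; apply.
by rewrite lerBlDr lerDl !mulr_ge0 ?invr_ge0 ?expR_ge0 // ltW.
Qed.

Lemma div_exp2_lt (R : realType) (D e : R) : 0 <= D -> 0 < e ->
  \forall n \near \oo, D / 2 ^+ n < e.
Proof.
move=> D0 e0; have h1 : `|2^-1 : R| < 1 by rewrite ger0_norm // invf_lt1 // ltr1n.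
have /cvgrPdist_lt/(_ _ e0) := cvg_geometric D h1.
apply: filterS => n; rewrite /geometric /= sub0r normrN exprVn ger0_norm //.
by rewrite divr_ge0 // exprn_ge0.
Qed.

Lemma geometric_cauchy_cvg (R : realType) (V : completeNormedModType R)
    (u : nat -> V) (D : R) :
  (forall n, `|u n.+1 - u n| <= D / 2 ^+ n) ->
  exists l, forall n, `|u n - l| <= 2 * D / 2 ^+ n.
Proof.
move=> Hu.
have D0 : 0 <= D by have := Hu 0%N; rewrite expr0 divr1; exact: le_trans.
have p2 n : 0 < (2 : R) ^+ n by rewrite exprn_gt0.
(* The subtracted term is what lets the induction close: it is the tail that has not been summed
   yet. *)
have dist n m : `|u (n + m)%N - u n| <= 2 * D / 2 ^+ n - 2 * D / 2 ^+ (n + m).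
  elim: m => [|m IH]; first by rewrite addn0 !subrr normr0.
  rewrite addnS -(subrKA (u (n + m)%N)).
  apply: (le_trans (ler_normD _ _)); apply: (le_trans (lerD (Hu _) IH)).
  rewrite exprS invfM.
  have : (2 ^+ (n + m))^-1 = 2 * (2^-1 * (2 ^+ (n + m))^-1) :> R.
    by rewrite mulrA divff ?mul1r.
  by move: ((2 ^+ (n + m))^-1) => y; lra.
have dist' n m : `|u (n + m)%N - u n| <= 2 * D / 2 ^+ n.
  apply: (le_trans (dist n m)); rewrite lerBlDr lerDl.
  by rewrite divr_ge0 ?mulr_ge0 // ltW.
have cu : cvg (u @ \oo).
  apply/cauchy_cvgP/cauchy_exP => e e0.
  have [N HN] := filter_ex (div_exp2_lt (mulr_ge0 (ler0n R 2) D0) e0).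
  exists (u N).
  exists N => // n /= Nn; rewrite -ball_normE /= distrC.
  by rewrite -(subnKC Nn); exact: le_lt_trans (dist' _ _) HN.
exists (limn u) => n; apply/ler_addgt0Pr => e e0.
have /cvgrPdist_lt/(_ _ e0)[N _ HN] := cu.
have /HN ue : (N <= n + N)%N by exact: leq_addl.
rewrite -(subrKA (u (n + N)%N)); apply: (le_trans (ler_normD _ _)).
apply: lerD; first by rewrite distrC.
by rewrite distrC ltW.
Qed.

(** Picard iteration in the weight [expR (K * |t|)] with [K = 2 L], which halves the distance at
    each step and gives a solution for all times. The bound [B] controls the first step and makes
    the iterates uniformly Lipschitz. *)
Lemma bounded_lipschitz_ode_exists (R : realType) (n : nat)
    (F : 'rV[R]_n -> 'rV[R]_n) (L B : R) (xi : 'rV[R]_n) :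
  0 < L -> 0 <= B -> (forall a, `|F a| <= B) ->
  (forall a b, `|F b - F a| <= L * `|b - a|) ->
  exists2 u : R -> 'rV[R]_n, u 0 = xi & forall t : R, is_derive t 1 u (F (u t)).
Proof.
move=> L0 B0 FB FL.
have cF : continuous F by exact: norm_lipschitz_continuous L0 FL.
(* The Picard operator as a total function; its value at a discontinuous [u] is arbitrary. *)
have /choice[A HA] : forall u : R -> 'rV[R]_n, exists v : R -> 'rV[R]_n,
    continuous u -> v 0 = xi /\ forall t : R, is_derive t 1 v (F (u t)).
  move=> u; have [cu|ncu] := pselect (continuous u); last by exists u.
  have [|G G0 dG] := @continuous_antiderivative_rV R n (F \o u).
    by move=> t; apply: continuous_comp; [exact: cu|exact: cF].
  exists (fun t => G t - (- xi)) => _; split; first by rewrite G0 opprK add0r.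
  by move=> t; rewrite -[F _]subr0; exact: is_derive1B (dG _) (is_derive1_cst _ _).
pose u := fix u n := if n is n'.+1 then A (u n') else fun=> xi.
have cu k : continuous (u k).
  elim: k => [|k IH]; first by move=> t; exact: cvg_cst.
  have [_ d] := HA _ IH; exact: is_derive1_continuous d.
have u0 k : u k 0 = xi by case: k => // k; have [] := HA _ (cu k).
have du k (t : R) : is_derive t 1 (u k.+1) (F (u k t)) by have [] := HA _ (cu k).
pose K := 2 * L; have K0 : 0 < K by rewrite mulr_gt0.
have step k (t : R) : `|u k.+1 t - u k t| <= B / K * expR (K * `|t|) / 2 ^+ k.
  elim: k t => [|k IH] t.
    rewrite expr0 divr1.
    apply: (@exp_increment_le _ _ (fun t => u 1%N t - xi) (fun t => F (u 0%N t) - 0)) => //.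
    - by rewrite u0 subrr.
    - move=> s; rewrite subr0; apply: (le_trans (FB _)); rewrite ler_peMr //.
      by rewrite -[leLHS]expR0 ler_expR mulr_ge0 // ltW.
  rewrite mulrAC.
  have -> : B / K / 2 ^+ k.+1 = (L * (B / K / 2 ^+ k)) / K.
    rewrite /K exprS; field.
    by rewrite !gt_eqF // exprn_gt0.
  apply: (@exp_increment_le _ _ (fun t => u k.+2 t - u k.+1 t)
    (fun t => F (u k.+1 t) - F (u k t))) => //.
  - by rewrite !mulr_ge0 ?invr_ge0 ?exprn_ge0 // ltW.
  - by rewrite !u0 subrr.
  - move=> s; apply: (le_trans (FL _ _)); rewrite -mulrA ler_wpM2l ?(ltW L0) //.
    by rewrite mulrAC; exact: IH.
have /choice[w Hw] : forall t, exists l, forall k,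
    `|u k t - l| <= 2 * (B / K * expR (K * `|t|)) / 2 ^+ k.
  move=> t; exact: (@geometric_cauchy_cvg _ _ (fun k => u k t) _ (fun k => step k t)).
have small (t e : R) : 0 < e -> \forall k \near \oo, `|u k t - w t| < e.
  move=> e0; have D0 : 0 <= 2 * (B / K * expR (K * `|t|)).
    by rewrite !mulr_ge0 ?invr_ge0 ?expR_ge0 // ltW.
  by apply: filterS (div_exp2_lt D0 e0) => k; exact: le_lt_trans (Hw t k).
exists w.
  apply/eqP; rewrite -subr_eq0 -normr_le0; apply/ler_addgt0Pr => e e0.
  have [k] := filter_ex (small 0 _ e0).
  by rewrite u0 distrC add0r => /ltW.
move=> t; apply/is_derive1P => k k0.
have LB1 : 0 < L * B + 1 by rewrite ltr_wpDl // mulr_ge0 // ltW.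
exists (k / (L * B + 1)); first by rewrite divr_gt0.
move=> s; rewrite ltr_pdivlMr // => /ltW std.
have lip m r : `|u m r - u m t| <= B * `|r - t|.
  case: m => [|m]; first by rewrite subrr normr0 mulr_ge0.
  by apply: (@mean_value_abs_le _ _ _ (fun r => F (u m r))) => r' _; split.
(* A linearization error quadratic in [s - t] and uniform in [m] survives the pointwise limit, so
   differentiability of [w] follows without uniform convergence. *)
have est m : `|u m.+1 s - u m.+1 t - (s - t) *: F (u m t)| <= L * B * `|s - t| * `|s - t|.
  have := @mean_value_abs_le _ _ (fun r => u m.+1 r - r *: F (u m t))
    (fun r => F (u m r) - F (u m t)) s t (L * B * `|s - t|).
  rewrite (_ : u m.+1 s - s *: _ - _ = u m.+1 s - u m.+1 t - (s - t) *: F (u m t)).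
    apply=> r rt; split; first exact: is_derive1B (du _ _) (is_derive_scalel _ _).
    apply: (le_trans (FL _ _)); rewrite -mulrA ler_wpM2l ?(ltW L0) //.
    by apply: (le_trans (lip _ _)); rewrite ler_wpM2l.
  by rewrite scalerBl !opprB (AC (2*2) ((1*4)*(3*2))).
apply: (@le_trans _ _ (L * B * `|s - t| * `|s - t|)); last first.
  by rewrite ler_wpM2r // (le_trans _ std) // mulrC ler_wpM2l // lerDl.
apply/ler_addgt0Pr => e e0.
(* Three limits are replaced by iterates: [w s], [w t], and [w t] inside [F]. The denominator counts
   their weights. *)
pose e' := e / (2 + `|s - t| * L).
have den : 0 < 2 + `|s - t| * L by rewrite ltr_pwDl // mulr_ge0 // ltW.
have e'0 : 0 < e' by rewrite divr_gt0.
have sh (P : nat -> Prop) : (\forall m \near \oo, P m) -> \forall m \near \oo, P m.+1.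
  by move=> [N _ HN]; exists N => // m /= Nm; apply: HN; exact: leqW.
have [m [[h1 h2] h3]] := filter_ex (filterI (filterI
  (sh (fun m => `|u m s - w s| < e') (small s _ e'0))
  (sh (fun m => `|u m t - w t| < e') (small t _ e'0))) (small t _ e'0)).
have -> : w s - w t - (s - t) *: F (w t) =
    (u m.+1 s - u m.+1 t - (s - t) *: F (u m t)) - (u m.+1 s - w s)
    + (u m.+1 t - w t) + (s - t) *: (F (u m t) - F (w t)).
  rewrite scalerBr [- (_ - w s)]opprB [RHS](AC (3*2*2*2) (4*7*9*(1*5)*(6*2)*(8*3))).
  by rewrite /= !subrr !addr0.
have -> : e = e' + e' + `|s - t| * (L * e').
  by rewrite /e'; field; rewrite gt_eqF.
rewrite [leRHS]addrA [X in _ <= X + _]addrA.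
apply: (le_trans (ler_normD _ _)); apply: lerD; last first.
  rewrite normrZ ler_wpM2l //; apply: (le_trans (FL _ _)).
  by rewrite ler_wpM2l ?(ltW L0) // ltW.
apply: (le_trans (ler_normD _ _)); apply: lerD; last exact: ltW.
apply: (le_trans (ler_normB _ _)); apply: lerD; last exact: ltW.
exact: est.
Qed.

(** * Dependence on the initial value *)

Lemma rV_norm_leP (R : realType) (n : nat) (a : 'rV[R]_n) (r : R) : 0 <= r ->
  `|a| <= r <-> forall j, `|a ord0 j| <= r.
Proof.
move=> r0; rewrite [`|a|]/Num.norm /= mx_normrE; split=> [ar j|ar].
  apply: le_trans ar.
  exact: (le_bigmax _ (fun ij : 'I_1 * 'I_n => `|a ij.1 ij.2|) (ord0, j)).
by apply/bigmax_leP; split=> // -[i j] _ /=; rewrite ord1.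
Qed.

(** The ball of the maximum norm is a cube, so clipping each coordinate retracts onto it with
    Lipschitz constant 1. *)
Definition clip (R : realType) (n : nat) (K : R) (a : 'rV[R]_n) : 'rV[R]_n :=
  \row_j Num.max (- K) (Num.min K (a ord0 j)).

Lemma clip_norm_le (R : realType) (n : nat) (K : R) (a : 'rV[R]_n) : 0 <= K ->
  `|clip K a| <= K.
Proof.
move=> K0; apply/rV_norm_leP => // j; rewrite mxE ler_norml.
rewrite le_max lexx /= ge_max ge_min lexx /= andbT; lra.
Qed.

Lemma clip_id (R : realType) (n : nat) (K : R) (a : 'rV[R]_n) :
  `|a| <= K -> clip K a = a.
Proof.
move=> aK; have K0 : 0 <= K by exact: le_trans aK.
apply/rowP => j; rewrite mxE; move/(rV_norm_leP _ K0)/(_ j) : aK.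
by rewrite ler_norml => /andP[h1 h2]; rewrite min_r // max_r.
Qed.

Lemma clip_lipschitz (R : realType) (n : nat) (K : R) (a b : 'rV[R]_n) :
  0 <= K -> `|clip K b - clip K a| <= `|b - a|.
Proof.
move=> K0; apply/rV_norm_leP => // j; rewrite !mxE.
have : `|b ord0 j - a ord0 j| <= `|b - a|.
  have /(rV_norm_leP _ (normr_ge0 _))/(_ j) := lexx `|b - a|.
  by rewrite !mxE.
apply: le_trans; move: (a ord0 j) (b ord0 j) => p q.
have := ler_norm (q - p); have := ler_norm (- (q - p)); rewrite normrN.
by case: (leP K p) => ?; case: (leP K q) => ?; case: (leP (- K) K) => ?;
  case: (leP (- K) p) => ?; case: (leP (- K) q) => ?; rewrite ler_norml; lra.
Qed.

(** The field [F] is [f] after [clip]. It need not be differentiable, so the variational equation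
    keeps using ['d f], bounded on the ball by the same [L]. *)
Lemma C1_truncation (R : realType) (f : 'rV[R]_2 -> 'rV[R]_2) (K : R) :
  C1_map f -> 0 <= K -> exists F : 'rV[R]_2 -> 'rV[R]_2, exists2 L, 0 < L &
    [/\ exists2 B, 0 <= B & forall a, `|F a| <= B,
        forall a b, `|F b - F a| <= L * `|b - a|,
        forall a, `|a| <= K -> F a = f a &
        forall c h, `|c| <= K -> `|'d f c h| <= L * `|h| ].
Proof.
move=> hf K0; have [L L0 [dL fL]] := C1_lipschitz_on_ball K hf.
exists (fun a => f (clip K a)), L => //.
have FL a b : `|f (clip K b) - f (clip K a)| <= L * `|b - a|.
  apply: le_trans (fL _ _ (clip_norm_le _ K0) (clip_norm_le _ K0)) _.
  by rewrite ler_wpM2l ?(ltW L0) // clip_lipschitz.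
split=> //; last by move=> a /clip_id ->.
exists (L * K + `|f 0|); first by rewrite addr_ge0 ?mulr_ge0 // ltW.
move=> a; rewrite -(subrK (f 0) (f _)); apply: (le_trans (ler_normD _ _)).
rewrite lerD2r; apply: (le_trans (fL _ _ _ (clip_norm_le _ K0))).
  by rewrite normr0.
by rewrite subr0 ler_wpM2l ?(ltW L0) // clip_norm_le.
Qed.

Lemma gronwall_derivable (R : realType) (V : normedModType R) (z dz : R -> V)
    (L k S : R) : 0 <= L -> 0 <= k ->
  (forall t : R, is_derive t 1 z (dz t)) ->
  (forall t, t \in `[0, S] -> `|dz t| <= L * `|z t| + k) ->
  forall t, t \in `[0, S] ->
    `|z t| <= 2 * expR (2 * L * S) * (`|z 0| + k * S).
Proof.
move=> L0 k0 dzt dzb t tS; move: (tS); rewrite in_itv /= => /andP[t0 tle].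
have := @gronwall R V z 0 S L k set0 L0 k0.
have cz : continuous z := is_derive1_continuous dzt.
move=> /(_ (continuous_subspaceT cz) (@small_variation0 _ _ _ _ _)) H.
apply: (le_trans (H _ t tS)); first by move=> s sS _; exists (dz s) => //; exact: dzb.
rewrite subr0 ler_pM ?mulr_ge0 ?addr_ge0 ?expR_ge0 ?mulr_ge0 //.
  by rewrite ler_wpM2l // ler_expR ler_wpM2l // mulr_ge0.
by rewrite lerD2l ler_wpM2l.
Qed.

Lemma linear_ode_zero (R : realType) (V : normedModType R) (z dz : R -> V)
    (L s : R) : 0 <= L ->
  (forall t : R, is_derive t 1 z (dz t)) -> (forall t, `|dz t| <= L * `|z t|) ->
  z s = 0 -> forall t, z t = 0.
Proof.
move=> L0.
have fwd (y dy : R -> V) : (forall t : R, is_derive t 1 y (dy t)) ->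
    (forall t, `|dy t| <= L * `|y t|) -> forall s t, s <= t -> y s = 0 -> y t = 0.
  move=> ddy dyb r t rt yr; apply/eqP; rewrite -normr_le0.
  have := @gronwall R V y r t L 0 set0 L0 (lexx 0).
  have cy : continuous y := is_derive1_continuous ddy.
  move=> /(_ (continuous_subspaceT cy) (@small_variation0 _ _ _ _ _)) H.
  have := H _ t; rewrite yr normr0 mul0r addr0 mulr0; apply.
    by move=> q _ _; exists (dy q) => //; rewrite addr0.
  by rewrite in_itv /= rt lexx.
move=> ddz dzb zs t; have [st|ts] := leP s t; first exact: (fwd z dz) st zs.
rewrite -(opprK t); apply: (fwd (fun r => z (- r)) (fun r => - dz (- r)) _ _ (- s)).
- by move=> r; exact: is_derive1_opp.
- by move=> r; rewrite normrN.
- by rewrite lerN2 ltW.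
- by rewrite opprK.
Qed.

Lemma flow_compare (R : realType) (V : normedModType R) (F : V -> V)
    (L S : R) (u v : R -> V) : 0 <= L ->
  (forall a b, `|F b - F a| <= L * `|b - a|) ->
  (forall t : R, is_derive t 1 u (F (u t))) ->
  (forall t : R, is_derive t 1 v (F (v t))) ->
  forall t, t \in `[0, S] -> `|u t - v t| <= 2 * expR (2 * L * S) * `|u 0 - v 0|.
Proof.
move=> L0 FL du dv t tS.
have := @gronwall_derivable R V (fun t => u t - v t) (fun t => F (u t) - F (v t))
  L 0 S L0 (lexx 0).
rewrite mul0r addr0; by apply => // r _; rewrite addr0.
Qed.

(** The strict bound by [K] persists a little before 0 and after [T], so [U] solves the equation of
    [f] on an open interval, as [flow_values] demands. Uniqueness shows that [xget] can pick no
    other value. *)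
Lemma Omega_value (R : realType) (f F : 'rV[R]_2 -> 'rV[R]_2) (K T : R)
    (U : R -> 'rV[R]_2) : C1_map f -> 0 < T ->
  (forall a, `|a| <= K -> F a = f a) ->
  (forall t : R, is_derive t 1 U (F (U t))) ->
  (forall t, t \in `[0, T] -> `|U t| < K) ->
  Omega_defined f T 0 (U 0) /\ Omega f T 0 (U 0) = U T.
Proof.
move=> hf T0 Ff dU UK.
have cU : continuous U := is_derive1_continuous dU.
have nearK t : t \in `[0, T] -> exists2 d, 0 < d &
    forall s, `|s - t| < d -> `|U s| < K.
  move=> tT; have : `|U s| @[s --> t] --> `|U t| by apply: cvg_norm; exact: cU.
  move=> /cvgr_lt /(_ K (UK _ tT)) /nbhs_ballP[d /= d0 Hd].
  by exists d => // s st; apply: Hd; rewrite /ball /= distrC.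
have [d0 d00 Hd0] : exists2 d, 0 < d & forall s, `|s - 0| < d -> `|U s| < K.
  by apply: nearK; rewrite in_itv /= lexx ltW.
have [d1 d10 Hd1] : exists2 d, 0 < d & forall s, `|s - T| < d -> `|U s| < K.
  by apply: nearK; rewrite in_itv /= lexx ltW.
have UT : flow_values f T 0 (U 0) (U T).
  exists (- d0), (T + d1), U; split=> //; [rewrite in_itv /=; lra..|].
  move=> t /=; rewrite in_itv /= => /andP[t1 t2].
  rewrite -Ff //; apply: ltW; have [t0|t0] := ltP t 0.
    by apply: Hd0; rewrite subr0 ltr0_norm //; lra.
  have [tT|tT] := ltP T t; last by apply: UK; rewrite in_itv /= t0.
  by apply: Hd1; rewrite gtr0_norm; lra.
split; first by exists (U T).
have uniq y : flow_values f T 0 (U 0) y -> y = U T.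
  move=> [a [b [u [a0 bT du u0 uT]]]]; rewrite -uT.
  move: a0 bT; rewrite !in_itv /= => /andP[a0 _] /andP[_ Tb].
  have sub t : t \in `[0, T] -> t \in `]a, b[.
    rewrite !in_itv /= => /andP[t0 tT].
    by rewrite (lt_le_trans a0) //= (le_lt_trans tT).
  have cu : {within `[0, T], continuous u}.
    apply: continuous_in_subspaceT => t; rewrite inE /= => /sub tab.
    apply: differentiable_continuous; apply/derivable1_diffP.
    by have [] := du t tab.
  have [c cT uc] : exists2 c, c \in `[0, T] & forall t, t \in `[0, T] ->
      `|u t| <= `|u c|.
    apply: EVT_max; first exact: ltW.
    by move=> s; apply: cvg_norm; exact: cu.
  (* A competing solution [u] may leave the ball of radius [K], but it is bounded on [[0, T]]; [f]
     is Lipschitz on a ball containing both curves. *)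
  pose K1 := Num.max K `|u c|.
  have [L L0 [_ fL]] := C1_lipschitz_on_ball K1 hf.
  have cz : {within `[0, T], continuous (fun t => u t - U t)}.
    by move=> s; apply: cvgB; [exact: cu|exact: (continuous_subspaceT cU)].
  have := @gronwall R _ (fun t => u t - U t) 0 T L 0 set0 (ltW L0) (lexx 0) cz
    (@small_variation0 _ _ _ _ _).
  have H t : t \in `[0, T] -> ~ set0 t -> exists2 v,
      is_derive t 1 (fun t => u t - U t) v & `|v| <= L * `|u t - U t| + 0.
    move=> tT _; exists (f (u t) - F (U t)).
      exact: is_derive1B (du t (sub t tT)) (dU t).
    rewrite addr0 Ff; last by exact/ltW/UK.
    apply: fL; rewrite le_max; first by rewrite ltW // UK.
    by rewrite uc // orbT.
  move=> /(_ H T); rewrite u0 subrr normr0 mul0r addr0 mulr0 in_itv /= lexx (ltW T0).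
  by move=> /(_ isT); rewrite normr_le0 subr_eq0 => /eqP.
by rewrite /Omega; apply: uniq; exact: (xgetI 0 UT).
Qed.

(** The error [z = U v2 - U v1 - (v2 - v1) w] starts at 0 and solves the variational equation up to
    the two-point linearization error of [f]. Gronwall's inequality then bounds it by a small
    multiple of [|v2 - v1|]. *)
Lemma flow_strongly_differentiable (R : realType) (f F : 'rV[R]_2 -> 'rV[R]_2)
    (K L S : R) (x0 w : R -> 'rV[R]_2) (U : R -> R -> 'rV[R]_2) :
  C1_map f -> 0 <= S -> 0 < L ->
  (forall a b, `|F b - F a| <= L * `|b - a|) ->
  (forall a, `|a| <= K -> F a = f a) ->
  (forall c h, `|c| <= K -> `|'d f c h| <= L * `|h|) ->
  (forall t, `|x0 t| <= K - 1) ->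
  (forall t : R, is_derive t 1 x0 (f (x0 t))) ->
  (forall t : R, is_derive t 1 w ('d f (x0 t) (w t))) ->
  (forall v, U v 0 = x0 0 + v *: w 0) ->
  (forall v (t : R), is_derive t 1 (U v) (F (U v t))) ->
  forall eta, 0 < eta -> exists2 delta, 0 < delta & forall v1 v2 t,
    `|v1| <= delta -> `|v2| <= delta -> t \in `[0, S] ->
    `|U v1 t| < K /\
    `|U v2 t - U v1 t - (v2 - v1) *: w t| <= eta * `|v2 - v1|.
Proof.
move=> hf S0 L0 FL Ff dfL x0K dx0 dw U0 dU eta eta0.
pose G := 2 * expR (2 * L * S).
have G0 : 0 < G by rewrite mulr_gt0 // expR_gt0.
pose W := `|w 0| + 1; have W0 : 0 < W by rewrite ltr_wpDl.
have x0K' t : `|x0 t| <= K by apply: (le_trans (x0K t)); rewrite gerBl.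
have UU v1 v2 t : t \in `[0, S] -> `|U v2 t - U v1 t| <= G * W * `|v2 - v1|.
  move=> tS; apply: le_trans (flow_compare (ltW L0) FL (dU v2) (dU v1) tS) _.
  rewrite !U0 [x0 0 + _]addrC addrKA -scalerBl normrZ -/G -mulrA.
  by rewrite ler_wpM2l ?(ltW G0) // mulrC ler_wpM2r // lerDl.
have Ux v t : t \in `[0, S] -> `|U v t - x0 t| <= G * W * `|v|.
  move=> tS.
  have dx0F (s : R) : is_derive s 1 x0 (F (x0 s)) by rewrite Ff.
  apply: le_trans (flow_compare (ltW L0) FL (dU v) dx0F tS) _.
  rewrite U0 addrC addKr normrZ -/G -mulrA.
  by rewrite ler_wpM2l ?(ltW G0) // mulrC ler_wpM2r // lerDl.
have GWS : 0 < G * (G * W * S) + 1.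
  by rewrite ltr_wpDl // !mulr_ge0 // ltW.
(* Gronwall's inequality multiplies [eta1] by [G * (G * W * S)]; the summand 1 keeps the denominator
   positive when [S = 0]. *)
pose eta1 := eta / (G * (G * W * S) + 1).
have eta10 : 0 < eta1 by rewrite divr_gt0.
have [d d0 Hd] := C1_strongly_differentiable K hf eta10.
have GW : 0 < G * W by rewrite mulr_gt0.
(* The curves [U v] stay within [d] of [x0], where the linearization of [f] is valid, and within
   [1 / 2], hence inside the ball of radius [K], where [F = f]. *)
exists (Num.min d (1 / 2) / (G * W)).
  by rewrite divr_gt0 // lt_min d0 divr_gt0.
move=> v1 v2 t; rewrite !ler_pdivlMr // !le_min => /andP[a1 a2] /andP[b1 b2] tS.
rewrite mulrC in a1; rewrite mulrC in a2; rewrite mulrC in b1; rewrite mulrC in b2.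
have UK v s : G * W * `|v| <= 1 / 2 -> s \in `[0, S] -> `|U v s| < K.
  move=> vs sS; rewrite -(subrK (x0 s) (U v s)).
  apply: (le_lt_trans (ler_normD _ _)).
  by have := Ux v s sS; have := x0K s; lra.
split; first exact: UK.
pose z t := U v2 t - U v1 t - (v2 - v1) *: w t.
pose dz t := F (U v2 t) - F (U v1 t) - (v2 - v1) *: 'd f (x0 t) (w t).
have dzE (s : R) : is_derive s 1 z (dz s).
  by apply: is_derive1B.
have zb := @gronwall_derivable R _ z dz L (eta1 * (G * W * `|v2 - v1|)) S (ltW L0) _ dzE.
have z0 : z 0 = 0.
  by rewrite /z !U0 [x0 0 + _]addrC addrKA -scalerBl subrr.
rewrite -/(z t); apply: le_trans (zb _ _ _ tS) _.
- by rewrite mulr_ge0 ?(ltW eta10) // mulr_ge0 // ltW.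
- move=> s sS; have -> : dz s = 'd f (x0 s) (z s) +
      (f (U v2 s) - f (U v1 s) - 'd f (x0 s) (U v2 s - U v1 s)).
    rewrite /dz /z !Ff; try by apply/ltW/UK.
    have -> : 'd f (x0 s) (U v2 s - U v1 s - (v2 - v1) *: w s) =
        'd f (x0 s) (U v2 s - U v1 s) - (v2 - v1) *: 'd f (x0 s) (w s).
      by rewrite linearB linearZ.
    by rewrite [RHS]addrC subrKA.
  apply: (le_trans (ler_normD _ _)); apply: lerD; first exact: dfL.
  apply: (@le_trans _ _ (eta1 * `|U v2 s - U v1 s|)).
    by apply: Hd => //; [apply: le_trans (Ux _ _ sS) _..].
  by rewrite ler_wpM2l ?(ltW eta10) // UU.
rewrite z0 normr0 add0r -/G.
have -> : G * (eta1 * (G * W * `|v2 - v1|) * S) =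
  (G * (G * W * S)) * eta1 * `|v2 - v1| by ring.
rewrite ler_wpM2r // /eta1 [_ * (eta / _)]mulrA ler_pdivrMr // mulrC ler_wpM2l ?(ltW eta0) //.
by rewrite lerDl.
Qed.

(** * Plane geometry and the variational equation *)

Lemma is_derive1_shift (R : realType) (V : normedModType R) (z : R -> V)
    (v : V) (t c : R) :
  is_derive (t - c) 1 z v -> is_derive t 1 (fun s => z (s - c)) v.
Proof.
move=> /is_derive1P H; apply/is_derive1P => k /H[d d0 Hd]; exists d => // s sd.
have E : s - c - (t - c) = s - t by rewrite opprB subrKA.
by have := Hd (s - c); rewrite E; apply.
Qed.

Lemma is_derive1_comp_diff (R : realType) (V W : normedModType R) (f : V -> W)
    (z : R -> V) (v : V) (t : R) : differentiable f (z t) ->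
  is_derive t 1 z v -> is_derive t 1 (fun s => f (z s)) ('d f (z t) v).
Proof.
move=> df [dz zv]; have dz' : differentiable z t by exact/derivable1_diffP.
have dfz : differentiable (f \o z) t by exact: differentiable_comp.
split; first exact/derivable1_diffP.
have <- : 'd z t 1 = v by rewrite -deriveE.
by rewrite deriveE // diff_comp.
Qed.

Lemma ae_increment_le (R : realType) (x : R -> 'rV[R]_2) (p : 'rV[R]_2)
    (a b k : R) : a <= b -> 0 <= k -> abs_continuous a b x ->
  {ae @lebesgue_measure R, forall t, t \in `[a, b] ->
    exists2 v, is_derive t 1 x v & `|v - p| <= k} ->
  `|x b - x a - (b - a) *: p| <= k * (b - a).
Proof.
move=> ab k0 acx H.
have acp : abs_continuous a b (fun t => t *: p).
  apply: (@lipschitz_abs_continuous _ a b (`|p| + 1)).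
    by rewrite ltr_wpDl.
  move=> s t _ st _; rewrite -scalerBl normrZ mulrC ger0_norm ?subr_ge0 //.
  by rewrite ler_wpM2r ?subr_ge0 // lerDl.
have := @small_variation_increment_le R _ (fun t => x t - t *: p)
  (fun t => k * t) (fun=> k) a b _ ab
  (abs_continuous_small_variation (abs_continuousB acx acp) H).
rewrite -mulrBr (_ : x b - b *: p - (x a - a *: p) = x b - x a - (b - a) *: p).
  apply.
    by move=> s t _ _ st; exact: ler_wpM2l.
  move=> t tab /contrapT /(_ tab)[v dv vk]; split.
    by apply: is_derive_eq; rewrite /GRing.scale /=; ring.
  exists (v - p) => //; exact: is_derive1B dv (is_derive_scalel p t).
by rewrite scalerBl !opprB [LHS](AC (2*2) ((1*4)*(3*2))).
Qed.

(** Gronwall's inequality for [x - Y (. - a)], with the defect [k] as forcing. Boundedness of [F]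
    makes [Y] Lipschitz, so that the difference is absolutely continuous. *)
Lemma ae_shadow (R : realType) (F : 'rV[R]_2 -> 'rV[R]_2) (L B k a b : R)
    (x Y : R -> 'rV[R]_2) : 0 <= L -> 0 <= B -> 0 <= k -> a <= b ->
  (forall u, `|F u| <= B) ->
  (forall u v, `|F v - F u| <= L * `|v - u|) ->
  abs_continuous a b x -> continuous x ->
  {ae @lebesgue_measure R, forall t, t \in `[a, b] ->
    exists2 v, is_derive t 1 x v & `|v - F (x t)| <= k} ->
  (forall t : R, is_derive t 1 Y (F (Y t))) ->
  forall t, t \in `[a, b] ->
    `|x t - Y (t - a)| <= 2 * expR (2 * L * (b - a)) * (`|x a - Y 0| + k * (b - a)).
Proof.
move=> L0 B0 k0 ab FB FL acx cx H dY t tab.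
have dYa (s : R) : is_derive s 1 (fun s => Y (s - a)) (F (Y (s - a))).
  exact: is_derive1_shift.
have acY : abs_continuous a b (fun s => Y (s - a)).
  apply: (@lipschitz_abs_continuous _ a b (B + 1)); first by rewrite ltr_wpDl.
  move=> r s _ rs _; rewrite -[s - r]ger0_norm ?subr_ge0 //.
  apply: (@mean_value_abs_le _ _ (fun s => Y (s - a)) (fun s => F (Y (s - a)))).
  by move=> q _; split; [exact: dYa|rewrite (le_trans (FB _)) // lerDl].
have cz : continuous (fun s => x s - Y (s - a)).
  by move=> s; apply: cvgB; [exact: cx|exact: is_derive1_continuous dYa s].
have := @gronwall R _ (fun s => x s - Y (s - a)) a b L k _ L0 k0
  (continuous_subspaceT cz)
  (abs_continuous_small_variation (abs_continuousB acx acY) H).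
move=> gr; apply: (le_trans (gr _ t tab)).
  move=> s sab /contrapT /(_ sab)[v dv vk].
  exists (v - F (Y (s - a))); first exact: is_derive1B dv (dYa s).
  rewrite -(subrKA (F (x s))) addrC; apply: (le_trans (ler_normD _ _)).
  exact: lerD.
move: tab; rewrite in_itv /= => /andP[at_ tb].
rewrite subrr ler_pM ?mulr_ge0 ?addr_ge0 ?expR_ge0 ?mulr_ge0 ?subr_ge0 //.
  by rewrite ler_wpM2l // ler_expR ler_wpM2l ?mulr_ge0 // lerD2r.
by rewrite lerD2l ler_wpM2l // lerD2r.
Qed.

Definition cross (R : realType) (u v : 'rV[R]_2) : R :=
  u ord0 0 * v ord0 1 - u ord0 1 * v ord0 0.

Lemma rV2P (R : realType) (u v : 'rV[R]_2) :
  u ord0 0 = v ord0 0 -> u ord0 1 = v ord0 1 -> u = v.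
Proof.
move=> h0 h1; apply/rowP => -[[|[|//]] i].
  by rewrite (_ : Ordinal i = 0) //; exact: val_inj.
by rewrite (_ : Ordinal i = 1) //; exact: val_inj.
Qed.

Lemma cramer2 (R : realType) (u v z : 'rV[R]_2) : cross u v != 0 ->
  z = (cross z v / cross u v) *: u + (cross u z / cross u v) *: v.
Proof.
by move=> uv; apply: rV2P; rewrite !mxE; move: uv; rewrite /cross => uv; field.
Qed.

Lemma cross0_colinear (R : realType) (u v : 'rV[R]_2) : u != 0 ->
  cross u v = 0 -> exists c, v = c *: u.
Proof.
move=> u0 uv; have [e0|n0] := eqVneq (u ord0 0) 0.
  have n1 : u ord0 1 != 0.
    by apply: contra_neq u0 => e1; apply: rV2P; rewrite !mxE.
  exists (v ord0 1 / u ord0 1); apply: rV2P; rewrite !mxE ?divfK // e0 mulr0.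
  apply/eqP; move: uv; rewrite /cross e0 mul0r sub0r => /eqP.
  by rewrite oppr_eq0 mulf_eq0 (negPf n1).
exists (v ord0 0 / u ord0 0); apply: rV2P; rewrite !mxE ?divfK //.
by apply: (mulfI n0); move/eqP: uv; rewrite /cross subr_eq0 => /eqP ->; field.
Qed.

Lemma cross_scaler (R : realType) (u : 'rV[R]_2) (c : R) : cross u (c *: u) = 0.
Proof. by rewrite /cross !mxE; ring. Qed.

Lemma cross_norm_le (R : realType) (u v : 'rV[R]_2) :
  `|cross u v| <= 2 * `|u| * `|v|.
Proof.
have ent (a : 'rV[R]_2) j : `|a ord0 j| <= `|a|.
  by have /(rV_norm_leP _ (normr_ge0 _))/(_ j) := lexx `|a|.
rewrite /cross; apply: (le_trans (ler_normB _ _)); rewrite !normrM.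
rewrite -mulrA [leRHS](_ : _ = `|u| * `|v| + `|u| * `|v|); last by ring.
by apply: lerD; apply: ler_pM.
Qed.

Lemma unitmx_cross (R : realType) (u v : 'rV[R]_2) :
  row_mx u^T v^T \in unitmx -> cross u v != 0.
Proof.
move=> uM.
have inj (c d : 'M[R]_1) : u^T *m c + v^T *m d = 0 -> d = 0 /\ c = 0.
  rewrite -mul_row_col => /(congr1 (mulmx (invmx (row_mx u^T v^T)))).
  rewrite mulKmx // mulmx0 => e; have {e} : (col_mx c d : 'M[R]_(1 + 1, 1)) = 0 by [].
  by move=> /eqP; rewrite col_mx_eq0 => /andP[/eqP-> /eqP->].
apply/negP => /eqP uv; have [u0|u0] := eqVneq u 0.
  have [|_ /eqP] := inj 1%:M 0; last by rewrite oner_eq0.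
  by rewrite u0 trmx0 mul0mx mulmx0 addr0.
have [c vE] := cross0_colinear u0 uv.
have [|/eqP] := inj (- c%:M) 1%:M; last by rewrite oner_eq0.
by rewrite vE linearZ /= mulmx1 mulmxN mul_mx_scalar addNr.
Qed.

Lemma plane_point_norm_le (R : realType) (a b r : R) : `|a| <= r -> `|b| <= r ->
  `|plane_point a b| <= r.
Proof.
move=> ar br; apply/rV_norm_leP => [|j]; first exact: le_trans ar.
by rewrite mxE; case: ifP.
Qed.

(** The point [s] is chosen before the function, so that one [s] serves [x0] and [x e]
    simultaneously. *)
Lemma periodic_reduce (R : realType) (T t : R) : 0 < T ->
  exists2 s, s \in `[0, T] & forall (U : Type) (x : R -> U), is_periodic T x ->
    x t = x s.
Proof.
move=> T0; pose k := Num.floor (t / T); exists (t - k%:~R * T).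
  have h1 : k%:~R <= t / T by exact: floor_le.
  have h2 : t / T < k%:~R + 1 by rewrite -[1]/(1%:~R) -intrD floorD1_gt.
  move: h1 h2; rewrite ler_pdivlMr // ltr_pdivrMr // in_itv /= mulrDl mul1r.
  by move=> h1 h2; apply/andP; split; lra.
move=> U x px.
have natp (n : nat) s : x (s + n%:R * T) = x s.
  elim: n s => [|n IH] s; first by rewrite mul0r addr0.
  by rewrite -natr1 mulrDl mul1r addrA px.
case: (k) => n; first by rewrite -[LHS](natp n) -{1}(subrK (n%:R * T) t) natp natp.
by rewrite NegzE mulrNz mulNr opprK natp.
Qed.

(* [w] is a combination of [x0'] and of the non-periodic solution given by
   nondegeneracy, so linear equations need no existence theorem. *)
Lemma cycle_variation (R : realType) (f : 'rV[R]_2 -> 'rV[R]_2) (K L T : R)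
    (x0 : R -> 'rV[R]_2) (A1 : 'rV[R]_2) :
  (forall a, differentiable f a) -> 0 <= L ->
  (forall c h, `|c| <= K -> `|'d f c h| <= L * `|h|) ->
  (forall t, `|x0 t| <= K) ->
  (forall t : R, is_derive t 1 x0 (f (x0 t))) ->
  is_periodic T x0 -> nondegenerate_cycle f T x0 ->
  cross (f (x0 0)) A1 != 0 ->
  exists w : R -> 'rV[R]_2, [/\ w 0 = A1,
    forall t : R, is_derive t 1 w ('d f (x0 t) (w t)),
    cross (f (x0 0)) (w T) != 0 & w (T + T) != w T].
Proof.
move=> df L0 dfL x0K dx0 px0 [y [dy npy]] pA.
pose lin z := forall t : R, is_derive t 1 z ('d f (x0 t) (z t)).
have lin0 z s : lin z -> z s = 0 -> forall t, z t = 0.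
  move=> lz; apply: (linear_ode_zero L0 lz) => t; exact: dfL.
have linD (a b : R) u v : lin u -> lin v -> lin (fun t => a *: u t + b *: v t).
  move=> lu lv t; rewrite linearD !linearZ /=.
  by apply: is_deriveD; exact: is_deriveZ.
pose p t := f (x0 t).
have lp : lin p by move=> t; exact: is_derive1_comp_diff.
have pT t : p (t + T) = p t by rewrite /p px0.
have p0 : p 0 != 0.
  by apply: contra_neq pA; rewrite -/(p 0) => ->; rewrite /cross !mxE !mul0r subrr.
have colin z s c : lin z -> z s = c *: p s -> forall t, z t = c *: p t.
  move=> lz zs t; apply/eqP; rewrite -subr_eq0; apply/eqP.
  have := @lin0 (fun t => 1 *: z t + (- c) *: p t) s (linD _ _ _ _ lz lp).
  by rewrite !scale1r scaleNr zs subrr => /(_ erefl t); rewrite scale1r scaleNr.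
(* Otherwise [y] would be a constant multiple of [p] for all times, hence periodic. *)
have py : cross (p 0) (y 0) != 0.
  apply/negP => /eqP /(cross0_colinear p0)[c yc]; apply: npy => t.
  by have cy := colin _ _ _ dy yc; rewrite !cy pT.
have [al [be A1E]] : exists al be, A1 = al *: p 0 + be *: y 0.
  by do 2 eexists; exact: (cramer2 A1 py).
pose w t := al *: p t + be *: y t.
have lw : lin w by exact: linD.
have be0 : be != 0.
  by apply: contra_neq pA => b0; rewrite A1E b0 scale0r addr0 cross_scaler.
exists w; split=> //.
- apply/negP => /eqP /(cross0_colinear p0)[c wc].
  have wc' : w T = c *: p T by rewrite wc -[in RHS](add0r T) pT.
  have := colin _ _ _ lw wc' 0; rewrite {1}/w -A1E => e.
  by move: pA; rewrite e cross_scaler eqxx.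
(* The coefficients are periodic, so [w (. + T) - w] is again a solution. Vanishing at [T], it
   vanishes identically; then [w], and with it [y], is periodic. *)
apply/eqP => wT; apply: npy => t.
have lz : lin (fun t => w (t - (- T)) - w t).
  move=> s; rewrite linearB; apply: is_derive1B => //.
  have := @is_derive1_shift R _ w _ s (- T) (lw _).
  by rewrite opprK px0.
have /(lin0 _ _ lz)/(_ t) : w (T - (- T)) - w T = 0 by rewrite opprK wT subrr.
rewrite opprK /w pT [X in X - _]addrC addrKA => /eqP; rewrite subr_eq0 => /eqP.
exact: scalerI.
Qed.

(* The map [(D, v) |-> X D - S v] is a small Lipschitz perturbation of the linear
   isomorphism [(D, v) |-> D p - v q]. *)
Lemma transversal_solution (R : realType) (p q : 'rV[R]_2)
    (X S : R -> 'rV[R]_2) (r s k : R) :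
  cross p q != 0 -> 0 < r -> 0 <= s ->
  k = 2 * (`|p| + `|q|) / `|cross p q| -> 4 * k * s <= 1 ->
  (forall a b, a \in `[- r, r] -> b \in `[- r, r] ->
    `|X b - X a - (b - a) *: p| <= s * `|b - a|) ->
  (forall a b, a \in `[- r, r] -> b \in `[- r, r] ->
    `|S b - S a - (b - a) *: q| <= s * `|b - a|) ->
  2 * k * `|X 0 - S 0| <= r ->
  exists D v, [/\ D \in `[- r, r], v \in `[- r, r] & X D = S v] /\
    [/\ `|D| <= 2 * k * `|X 0 - S 0|, `|v| <= 2 * k * `|X 0 - S 0| &
     forall D' v', D' \in `[- r, r] -> v' \in `[- r, r] -> X D' = S v' ->
       D' = D /\ v' = v].
Proof.
move=> pq r0 s0 kE ks HX HS small.
have k0 : 0 <= k by rewrite kE divr_ge0 // mulr_ge0 // addr_ge0.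
have inI a : (a \in `[- r, r]) = (`|a| <= r) by rewrite in_itv /= ler_norml.
(* Cramer's rule: [A] inverts the map [e] below, and [k] bounds its norm. *)
pose A z : 'rV[R]_2 := plane_point (cross z q / cross p q) (- (cross p z / cross p q)).
have A0 (z : 'rV[R]_2) : (A z) ord0 0 = cross z q / cross p q by rewrite mxE.
have A1 (z : 'rV[R]_2) : (A z) ord0 1 = - (cross p z / cross p q) by rewrite mxE.
have kD : k * `|cross p q| = 2 * (`|p| + `|q|) by rewrite kE divfK // normr_eq0.
have Ak z : `|A z| <= k * `|z|.
  have cpq : 0 < `|cross p q| by rewrite normr_gt0.
  apply: plane_point_norm_le; rewrite ?normrN normrM normfV ler_pdivrMr //.
    apply: (le_trans (cross_norm_le _ _)); rewrite [leRHS]mulrAC kD.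
    by have := mulr_ge0 (normr_ge0 z) (normr_ge0 p); lra.
  apply: (le_trans (cross_norm_le _ _)); rewrite [leRHS]mulrAC kD.
  by have := mulr_ge0 (normr_ge0 z) (normr_ge0 q); lra.
have AB u v : A (u - v) = A u - A v.
  by apply: rV2P; rewrite !(A0, A1, mxE) /cross !mxE; ring.
pose e (a : 'rV[R]_2) := a ord0 0 *: p - a ord0 1 *: q.
have Ae a : A (e a) = a.
  by apply: rV2P; rewrite !(A0, A1) /e /cross !mxE; move: pq; rewrite /cross => pq; field.
have A_inj z : A z = 0 -> z = 0.
  move=> Az; rewrite (cramer2 z pq).
  have := congr1 (fun a : 'rV[R]_2 => a ord0 0) Az; rewrite A0 mxE => ->.
  have := congr1 (fun a : 'rV[R]_2 => a ord0 1) Az; rewrite A1 mxE => /eqP.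
  by rewrite oppr_eq0 => /eqP ->; rewrite !scale0r addr0.
pose G (a : 'rV[R]_2) := X (a ord0 0) - S (a ord0 1).
(* Newton's map with frozen derivative. Its fixed points are the zeros of [G], as [A] is injective.
   Two errors of size [s] pass through [A], so [4 k s <= 1] gives the contraction factor [1 / 2]. *)
pose H (a : 'rV[R]_2) := a - A (G a).
have ballP (a : 'rV[R]_2) : `|a| <= r -> a ord0 0 \in `[- r, r] /\ a ord0 1 \in `[- r, r].
  by move=> /(rV_norm_leP _ (ltW r0)) ar; rewrite !inI; split.
have Hc (a b : 'rV[R]_2) : `|a| <= r -> `|b| <= r -> `|H b - H a| <= 1 / 2 * `|b - a|.
  move=> /ballP[a0 a1] /ballP[b0 b1].
  have -> : H b - H a = A (e (b - a) - (G b - G a)).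
    by rewrite AB Ae AB /H !opprB (AC (2*2) ((1*4)*(3*2))).
  apply: (le_trans (Ak _)).
  have nb j : `|b ord0 j - a ord0 j| <= `|b - a|.
    by have /(rV_norm_leP _ (normr_ge0 _))/(_ j) := lexx `|b - a|; rewrite !mxE.
  have : `|e (b - a) - (G b - G a)| <= s * `|b - a| + s * `|b - a|.
    have -> : e (b - a) - (G b - G a) =
      - ((X (b ord0 0) - X (a ord0 0) - (b ord0 0 - a ord0 0) *: p)
      - (S (b ord0 1) - S (a ord0 1) - (b ord0 1 - a ord0 1) *: q)).
      rewrite /e /G !mxE -[LHS]opprK; congr (- _).
      by rewrite !opprB (AC (2*2*2) (1*4*6*(5*(3*2)))).
    rewrite normrN; apply: (le_trans (ler_normB _ _)); apply: lerD.
      by apply: (le_trans (HX _ _ a0 b0)); rewrite ler_wpM2l.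
    by apply: (le_trans (HS _ _ a1 b1)); rewrite ler_wpM2l.
  move=> /(ler_wpM2l k0) /le_trans; apply.
  rewrite [leLHS](_ : _ = 4 * k * s / 2 * `|b - a|); last by field.
  by rewrite ler_wpM2r // ler_pM2r // invr_gt0.
have H0 : `|H 0| <= k * `|X 0 - S 0|.
  by rewrite /H sub0r normrN; apply: (le_trans (Ak _)); rewrite /G !mxE.
have Hr a : `|a| <= r -> `|H a| <= r.
  move=> ar; have := Hc 0 a; rewrite normr0 subr0 => /(_ (ltW r0) ar) h.
  rewrite -(subrK (H 0) (H a)); apply: (le_trans (ler_normD _ _)).
  by move: h H0 small ar; lra.
pose u n := iter n H 0.
have ur n : `|u n| <= r by elim: n => [|n IH] /=; [rewrite normr0 ltW|exact: Hr].
have ustep n : `|u n.+1 - u n| <= r / 2 ^+ n.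
  elim: n => [|n IH]; first by rewrite expr0 divr1 subr0 ur.
  apply: (le_trans (Hc _ _ (ur n) (ur n.+1))); rewrite exprS invfM mulrCA div1r.
  by rewrite ler_wpM2l.
have [l ul] := geometric_cauchy_cvg ustep.
have r2 : 0 <= 2 * r by rewrite mulr_ge0 // ltW.
have lr : `|l| <= r.
  apply/ler_addgt0Pr => e0 e00; have [n /ltW nE] := filter_ex (div_exp2_lt r2 e00).
  rewrite -(subrK (u n) l) addrC; apply: (le_trans (ler_normD _ _)).
  by apply: lerD => //; rewrite distrC (le_trans (ul n)).
have Hl : H l = l.
  apply/eqP; rewrite -subr_eq0 -normr_le0; apply/ler_addgt0Pr => e0 e00.
  have e2 : 0 < e0 / 2 by rewrite divr_gt0.
  have [n /ltW nE] := filter_ex (div_exp2_lt r2 e2).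
  have uln : `|u n - l| <= e0 / 2 by exact: le_trans (ul n) nE.
  have uln1 : `|u n.+1 - l| <= e0 / 2.
    apply: (le_trans (ul n.+1)); apply: le_trans nE; apply: ler_wpM2l => //.
    by rewrite lef_pV2 ?posrE ?exprn_gt0 // exprS ler_peMl ?exprn_ge0 // ler1n.
  rewrite add0r -(subrKA (u n.+1)); apply: (le_trans (ler_normD _ _)).
  by have := Hc _ _ (ur n) lr; rewrite [`|l - _|]distrC => h; rewrite -/(H (u n)); lra.
have Gl : G l = 0.
  apply: A_inj; move/eqP: Hl; rewrite /H -subr_eq0 addrC addKr oppr_eq0.
  by move/eqP.
have lsmall : `|l| <= 2 * k * `|X 0 - S 0|.
  have := Hc 0 l; rewrite normr0 subr0 Hl => /(_ (ltW r0) lr) h.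
  have : `|l| <= `|l - H 0| + `|H 0| by rewrite -[in leLHS](subrK (H 0) l) ler_normD.
  by move: h H0; lra.
exists (l ord0 0), (l ord0 1); have [l0 l1] := ballP _ lr; split.
  by split=> //; apply/eqP; rewrite -subr_eq0 -/(G l) Gl.
split.
- by move/(rV_norm_leP _ (le_trans (normr_ge0 _) lsmall)) : lsmall; apply.
- by move/(rV_norm_leP _ (le_trans (normr_ge0 _) lsmall)) : lsmall; apply.
move=> D' v'; rewrite !inI => D'r v'r XS; pose a : 'rV[R]_2 := plane_point D' v'.
have ar : `|a| <= r by exact: plane_point_norm_le.
have A00 : A 0 = 0 by rewrite -(subrr (0 : 'rV[R]_2)) AB !subrr.
have Ga : G a = 0 by rewrite /G !mxE /= XS subrr.
have Ha : H a = a by rewrite /H Ga A00 subr0.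
have : `|l - a| <= 1 / 2 * `|l - a| by rewrite -[in leLHS]Hl -[in leLHS]Ha Hc.
have := normr_ge0 (l - a) => h1 h2.
have : `|l - a| <= 0 by lra.
by rewrite normr_le0 subr_eq0 => /eqP ->; rewrite !mxE.
Qed.

(** * Periodic solutions of the inclusion *)

Lemma lebesgue_ae2 (R : realType) (P Q S : R -> Prop) :
  {ae @lebesgue_measure R, forall t, P t} -> {ae @lebesgue_measure R, forall t, Q t} ->
  (forall t, P t -> Q t -> S t) -> {ae @lebesgue_measure R, forall t, S t}.
Proof.
move=> aeP aeQ H.
have FF : Filter (almost_everywhere (@lebesgue_measure R)).
  exact: ae_filter_ringOfSetsType.
exact: (@filterS2 _ _ FF _ _ _ H aeP aeQ).
Qed.

Lemma lebesgue_aeS (R : realType) (P S : R -> Prop) :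
  {ae @lebesgue_measure R, forall t, P t} ->
  (forall t, P t -> S t) -> {ae @lebesgue_measure R, forall t, S t}.
Proof. by move=> aeP H; apply: (lebesgue_ae2 aeP aeP) => t /H. Qed.

(** The constant [C] depends only on the ball and the time window, not on [e] or on the solution: it
    is an essential bound of [mu] on [[a, b]]. *)
Lemma inclusion_defect_le (R : realType) (f : 'rV[R]_2 -> 'rV[R]_2)
    (g : R -> 'rV[R]_2 -> R -> set 'rV[R]_2) (T K a b : R) :
  (forall t y e, e \in `[0, 1] -> in_K (g t y e)) ->
  (forall B : set 'rV[R]_2, bounded_set B -> exists2 mu : R -> R, Linfty_loc mu &
     forall t y e, B y -> e \in `[0, 1] -> sup [set `|z| | z in g t y e] <= mu t) ->
  exists2 C, 0 <= C & forall e x, e \in `[0, 1] ->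
    periodic_inclusion_solution f g T e x -> (forall t, `|x t| <= K) ->
    {ae @lebesgue_measure R, forall t, t \in `[a, b] ->
      exists2 v, is_derive t 1 x v & `|v - f (x t)| <= e * C}.
Proof.
move=> gK gB; have [|mu [_ muL] Hmu] := gB [set y | `|y| <= K].
  by apply: compact_bounded; exact: closed_norm_ball_compact.
have [C muabC] := muL a b; exists `|C| => // e x e01 [_ _ xae] xK.
have e0 : 0 <= e by move: e01; rewrite in_itv => /andP[].
apply: (lebesgue_ae2 muabC xae) => t muC [dx [y gy dxE]] tab.
exists (derive1 x t); first by rewrite derive1E; exact: derivableP.
rewrite dxE addrAC subrr add0r normrZ ger0_norm // ler_wpM2l //.
apply: (@le_trans _ _ (mu t)); last first.
  by rewrite (le_trans (ler_norm _)) // (le_trans (muC tab)) // ler_norm.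
apply: le_trans (Hmu t (x t) e (xK t) e01).
(* Compactness of the values of [g] bounds the set of norms, so that [sup] really is its
   supremum. *)
apply: ub_le_sup; last by exists y.
have [_ /compact_bounded[M [_ HM]] _] := gK t (x t) e e01.
exists (`|M| + 1) => _ [z gz <-]; apply: HM => //.
by rewrite (le_lt_trans (ler_norm M)) // ltrDl.
Qed.

Lemma periodic_bounded (R : realType) (T : R) (x : R -> 'rV[R]_2) : 0 < T ->
  continuous x -> is_periodic T x -> exists2 M, 0 <= M & forall t, `|x t| <= M.
Proof.
move=> T0 cx px; have [c cT xc] : exists2 c, c \in `[0, T] & forall t, t \in `[0, T] ->
    `|x t| <= `|x c|.
  apply: EVT_max; first exact: ltW.
  by apply: continuous_subspaceT => t; apply: cvg_norm; exact: cx.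
exists `|x c| => // t; have [s sT E] := periodic_reduce t T0.
by rewrite (E _ _ px) xc.
Qed.

Unset Implicit Arguments.

Theorem theorem1 (R : realType) (f : 'rV[R]_2 -> 'rV[R]_2) (T : R)
    (x0 : R -> 'rV[R]_2) (g : R -> 'rV[R]_2 -> R -> set 'rV[R]_2)
    (x : R -> R -> 'rV[R]_2) (A1 : 'rV[R]_2)
    (hf : C1_map f)
    (hT : 0 < T)
    (hx0 : periodic_cycle f T x0)
    (hnd : nondegenerate_cycle f T x0)
    (hgK : forall t y e, e \in `[0, 1] -> in_K (g t y e))
    (hgT : forall t y e, e \in `[0, 1] -> g (t + T) y e = g t y e)
    (hgm : multi_measurable g)
    (hgb : forall B : set 'rV[R]_2, bounded_set B ->
       exists2 mu : R -> R, Linfty_loc mu &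
         forall t y e, B y -> e \in `[0, 1] ->
           sup [set `|z| | z in g t y e] <= mu t)
    (hx : \forall e \near 0^'+, periodic_inclusion_solution f g T e (x e))
    (hconv : forall eta : R, 0 < eta -> \forall e \near 0^'+,
       forall t, t \in `[0, T] -> `|x e t - x0 t| < eta)
    (hA1 : row_mx (derive1 x0 0)^T A1^T \in unitmx) :
  let S (v : R) := Omega f T 0 (x0 0 + v *: A1) in
  let S_defined (v : R) := Omega_defined f T 0 (x0 0 + v *: A1) in
  exists eps0 r0 M : R, [/\ 0 < eps0, 0 < r0 & 0 < M] /\
    exists Delta nu : R -> R,
      [/\ forall e, e \in `]0, eps0] ->
            let solution D v :=
              [/\ D \in `[- r0, r0], v \in `[- r0, r0],
                  S_defined v & x e D = S v] in
            solution (Delta e) (nu e) /\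
            (forall D v, solution D v -> D = Delta e /\ v = nu e),
          Delta @ 0^'+ --> (0 : R),
          nu @ 0^'+ --> (0 : R) &
          forall e, e \in `]0, eps0] -> forall t, t \in `[0, T] ->
            `|x e (t + Delta e) - x0 t| <= M * e].
Proof.
move=> S S_defined.
have [ode_x0 _ px0 _] := hx0.
have dx0 (t : R) : is_derive t 1 x0 (f (x0 t)) by exact: ode_x0.
have df : forall a, differentiable f a by case: hf.
have pA : cross (f (x0 0)) A1 != 0.
  apply: unitmx_cross; move: hA1; rewrite derive1E.
  by have [_ ->] := dx0 0.
have cx0 : continuous x0 := is_derive1_continuous dx0.
have [K1 K10 x0K1] := periodic_bounded hT cx0 px0.
(* The margin 1 keeps the nearby curves [x e] and [U v] in the ball where [F = f]. *)
pose K := K1 + 1.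
have K0 : 0 <= K by rewrite addr_ge0.
have x0K t : `|x0 t| <= K by rewrite (le_trans (x0K1 t)) // lerDl.
have [F [L L0 [[B B0 FB] FL Ff dfL]]] := C1_truncation hf K0.
have [w [w0 dw pq wTT]] := cycle_variation df (ltW L0) dfL x0K dx0 px0 hnd pA.
have /choice[U HU] : forall v : R, exists u : R -> 'rV[R]_2,
    u 0 = x0 0 + v *: A1 /\ forall t : R, is_derive t 1 u (F (u t)).
  move=> v; have [u] := bounded_lipschitz_ode_exists (x0 0 + v *: A1) L0 B0 FB FL.
  by exists u.
have dU v (t : R) : is_derive t 1 (U v) (F (U v t)) by case: (HU v) => _; apply.
have U0w v : U v 0 = x0 0 + v *: w 0 by rewrite w0; case: (HU v).
have dx0F (t : R) : is_derive t 1 x0 (F (x0 t)) by rewrite Ff.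
have T2 : 0 <= T + T by rewrite addr_ge0 // ltW.
have Ux0 t : t \in `[0, T + T] -> U 0 t = x0 t.
  move=> tT; apply/eqP; rewrite -subr_eq0 -normr_le0.
  have := flow_compare (ltW L0) FL (dU 0) dx0F tT.
  by rewrite U0w scale0r addr0 subrr normr0 mulr0.
pose p := f (x0 0); pose q := w T.
pose k := 2 * (`|p| + `|q|) / `|cross p q|.
have k0 : 0 <= k by rewrite divr_ge0 // mulr_ge0 // addr_ge0.
pose s := (4 * (k + 1))^-1.
have s0 : 0 < s by rewrite invr_gt0 mulr_gt0 // ltr_wpDl.
have ks : 4 * k * s <= 1.
  by rewrite /s ler_pdivrMr ?mul1r ?mulr_gt0 ?ltr_wpDl // ler_wpM2l // lerDl.
have x0K' t : `|x0 t| <= K - 1 by rewrite /K addrK.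
have strong := flow_strongly_differentiable hf T2 L0 FL Ff dfL x0K' dx0 dw U0w dU.
pose om := `|w (T + T) - w T|.
have om0 : 0 < om by rewrite normr_gt0 subr_eq0.
(* The error is incurred at [T] and at [T + T]; together they consume half of [om * |v|]. *)
have om4 : 0 < om / 4 by rewrite divr_gt0.
have [d1 d10 Hd1] := strong _ s0.
have [d2 d20 Hd2] := strong _ om4.
have Ls : 0 < s / (4 * L) by rewrite divr_gt0 // mulr_gt0.
have [d3 d30 Hd3] : exists2 d, 0 < d & forall t, `|t| < d -> `|x0 t - x0 0| <= s / (4 * L).
  have /cvgrPdist_le/(_ _ Ls)/nbhs_ballP[d /= d0 Hd] := cx0 0.
  exists d => // t td; rewrite distrC; apply: Hd.
  by rewrite /ball /= sub0r normrN.
(* The bound [T] keeps every window [[D, D + T]] inside [[- T, T + T]], where the defect bound [C]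
   holds; [d3] keeps the velocity of [x0] close to [p]. *)
pose r0 := Num.min (Num.min T (d3 / 2)) (Num.min d1 d2).
have r00 : 0 < r0 by rewrite !lt_min hT d10 d20 divr_gt0.
have r0T : r0 <= T by rewrite /r0 !ge_min lexx.
have r0d1 : r0 <= d1 by rewrite /r0 !ge_min lexx !orbT.
have r0d2 : r0 <= d2 by rewrite /r0 !ge_min lexx !orbT.
have r0d3 : r0 < d3.
  by rewrite /r0 !gt_min (_ : d3 / 2 < d3) ?orbT // ltr_pdivrMr // ltr_pMr // ltr1n.
have TI : T \in `[0, T + T] by rewrite in_itv /= ltW //= lerDl ltW.
have TTI : T + T \in `[0, T + T] by rewrite in_itv /= lexx T2.
have inr v : (v \in `[- r0, r0]) = (`|v| <= r0) by rewrite in_itv /= ler_norml.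
have SU v : `|v| <= r0 -> S_defined v /\ S v = U v T.
  move=> vr; have := @Omega_value _ f F K T (U v) hf hT Ff (dU v).
  rewrite U0w w0; apply => t tT.
  have tTT : t \in `[0, T + T].
    by move: tT; rewrite !in_itv /= => /andP[-> /le_trans]; apply; rewrite lerDl ltW.
  by have [] := Hd1 v v t (le_trans vr r0d1) (le_trans vr r0d1) tTT.
have [C C0 HC] := @inclusion_defect_le R f g T K (- T) (T + T) hgK hgb.
(* In turn: [x e] stays in the ball of radius [K], its velocity stays close to that of [x0], and the
   starting error of the contraction is at most [r0]. *)
pose rho := Num.min (Num.min 1 (s / (4 * L))) (r0 / (2 * k + 1)).
have k21 : 0 < 2 * k + 1 by rewrite ltr_wpDl // mulr_ge0.
have rho0 : 0 < rho by rewrite !lt_min ltr01 Ls divr_gt0.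
have sC : 0 < s / (2 * (C + 1)) by rewrite divr_gt0 // mulr_gt0 // ltr_wpDl.
pose good e := [/\ 0 < e, e <= 1, e * C <= s / 2,
  periodic_inclusion_solution f g T e (x e) &
  forall t, t \in `[0, T] -> `|x e t - x0 t| < rho].
have : \forall e \near 0^'+, good e.
  have h1 : \forall e \near (0 : R)^'+, e <= 1 by exact: nbhs_right_le.
  have h2 : \forall e \near (0 : R)^'+, e <= s / (2 * (C + 1)) by exact: nbhs_right_le.
  have h3 : \forall e \near (0 : R)^'+, 0 < e by exact: nbhs_right_gt.
  apply: (filterS _ (filterI (filterI h1 h2) (filterI h3 (filterI hx (hconv _ rho0))))).
  move=> e [[e1 e2] [e0 [xe ce]]]; split=> //.
  move: e2; rewrite ler_pdivlMr ?mulr_gt0 ?ltr_wpDl //; move=> e2.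
  have : e * C <= e * (C + 1) by rewrite ler_wpM2l ?(ltW e0) // lerDl.
  by clear - e2; lra.
move=> /nbhs_ballP[d /= d0 Hd].
pose eps0 := d / 2.
have eps00 : 0 < eps0 by rewrite divr_gt0.
have goodP e : e \in `]0, eps0] -> good e.
  rewrite in_itv /= => /andP[e0 ee]; apply: Hd => //.
  rewrite /ball /= sub0r normrN gtr0_norm // (le_lt_trans ee) //.
  by rewrite /eps0 ltr_pdivrMr // ltr_pMr // ltr1n.
have approx e : good e -> [/\ continuous (x e), (forall a b, abs_continuous a b (x e)),
    is_periodic T (x e), (forall t, `|x e t - x0 t| <= rho /\ `|x e t| <= K) &
    {ae @lebesgue_measure R, forall t, t \in `[- T, T + T] ->
      exists2 v, is_derive t 1 (x e) v & `|v - F (x e t)| <= e * C}].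
  move=> [e0 e1 eC xe ce]; have [pxe acx _] := xe.
  have cl t : `|x e t - x0 t| <= rho.
    have [r rT E] := periodic_reduce t hT.
    by rewrite (E _ _ pxe) (E _ _ px0); apply/ltW/ce.
  have xK t : `|x e t| <= K.
    rewrite -(subrK (x0 t) (x e t)); apply: (le_trans (ler_normD _ _)).
    rewrite /K addrC; apply: lerD => //; apply: (le_trans (cl t)).
    by rewrite /rho !ge_min lexx.
  split=> //; first exact: abs_continuous_continuous.
  have eI : e \in `[0, 1] by rewrite in_itv /= e1 ltW.
  apply: (lebesgue_aeS (HC e (x e) eI xe xK)) => t H tT; have [v dv vb] := H tT.
  by exists v => //; rewrite Ff.
have L3 : L * (s / (4 * L)) = s / 4 by field; rewrite gt_eqF.
have Lrho : L * rho <= s / 4.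
  apply: (@le_trans _ _ (L * (s / (4 * L)))); last by rewrite L3.
  by rewrite ler_wpM2l ?(ltW L0) // /rho !ge_min lexx orbT.
(* The equation is solved with [U v T] in place of [S v]. For [e] outside the range the pair is
   arbitrary. *)
have exsol e : exists z : R * R, e \in `]0, eps0] ->
    [/\ z.1 \in `[- r0, r0], z.2 \in `[- r0, r0] & x e z.1 = U z.2 T] /\
    [/\ `|z.1| <= 2 * k * `|x e 0 - x0 0|, `|z.2| <= 2 * k * `|x e 0 - x0 0| &
     forall D' v', D' \in `[- r0, r0] -> v' \in `[- r0, r0] -> x e D' = U v' T ->
       D' = z.1 /\ v' = z.2].
  have [eI|] := boolP (e \in `]0, eps0]); last by exists (0, 0).
  have ge := goodP _ eI; have [cxe acx pxe /all_and2[cl xK] aex] := approx _ ge.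
  have [e0 e1 eC _ _] := ge.
  have U0T : U 0 T = x0 0 by rewrite Ux0 // -[T]add0r px0.
  have HX1 a b : a \in `[- r0, r0] -> b \in `[- r0, r0] -> a <= b ->
      `|x e b - x e a - (b - a) *: p| <= s * (b - a).
    rewrite !in_itv /= => /andP[a1 _] /andP[_ b1] ab.
    apply: ae_increment_le => //; first exact: ltW.
    apply: (lebesgue_aeS aex) => t H; rewrite in_itv /= => /andP[at_ tb].
    have [|v dv vF] := H.
      by clear - a1 b1 at_ tb r0T hT; rewrite in_itv /=; apply/andP; split; lra.
    exists v => //; rewrite -(subrKA (F (x e t))); apply: (le_trans (ler_normD _ _)).
    (* This is at most [s / 4 + s / 4]; the defect [e * C] takes the remaining [s / 2]. *)
    have : `|F (x e t) - p| <= L * (rho + s / (4 * L)).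
      rewrite /p -Ff //; apply: (le_trans (FL _ _)); rewrite ler_wpM2l ?(ltW L0) //.
      rewrite -(subrKA (x0 t)); apply: (le_trans (ler_normD _ _)); apply: lerD => //.
      apply: Hd3; rewrite (le_lt_trans _ r0d3) // ler_norml.
      by clear - a1 b1 at_ tb; apply/andP; split; lra.
    by rewrite mulrDr L3; clear - vF Lrho eC; lra.
  have HX a b : a \in `[- r0, r0] -> b \in `[- r0, r0] ->
      `|x e b - x e a - (b - a) *: p| <= s * `|b - a|.
    move=> aI bI; have [ab|/ltW ba] := leP a b.
      by rewrite [`|b - a|]ger0_norm ?subr_ge0 //; exact: HX1.
    have -> : x e b - x e a - (b - a) *: p = - (x e a - x e b - (a - b) *: p).
      by rewrite -[b - a]opprB scaleNr !opprB opprK addrC.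
    by rewrite normrN [`|b - a|]distrC [`|a - b|]ger0_norm ?subr_ge0 //; exact: HX1.
  have HS a b : a \in `[- r0, r0] -> b \in `[- r0, r0] ->
      `|U b T - U a T - (b - a) *: q| <= s * `|b - a|.
    rewrite !inr => aI bI.
    by have [] := Hd1 a b T (le_trans aI r0d1) (le_trans bI r0d1) TI.
  have small : 2 * k * `|x e 0 - U 0 T| <= r0.
    rewrite U0T; apply: (@le_trans _ _ ((2 * k + 1) * rho)).
      by rewrite ler_pM // ?mulr_ge0 // lerDl.
    by rewrite mulrC -ler_pdivlMr // /rho !ge_min lexx orbT.
  have [D [v]] := transversal_solution (S := fun v => U v T) pq r00 (ltW s0)
    (erefl k) ks HX HS small.
  by rewrite U0T => H; exists (D, v).
have {exsol} /choice[z Hz] := exsol.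
pose G := 2 * expR (2 * L * T).
have G0 : 0 < G by rewrite mulr_gt0 // expR_gt0.
(* Used twice: with [Y = U v (T + .)], where the initial gap is 0, and with [Y = x0], where it is
   [O(e)]. *)
have shadow e Y D t : good e -> `|D| <= r0 -> (forall t : R, is_derive t 1 Y (F (Y t))) ->
    t \in `[0, T] -> `|x e (t + D) - Y t| <= G * (`|x e D - Y 0| + e * C * T).
  move=> ge Dr dY tT; have [cxe acx pxe /all_and2[cl xK] aex] := approx _ ge.
  have [e0 e1 eC _ _] := ge.
  have DT : D <= D + T by rewrite lerDl ltW.
  have aeD : {ae @lebesgue_measure R, forall t, t \in `[D, D + T] ->
      exists2 v, is_derive t 1 (x e) v & `|v - F (x e t)| <= e * C}.
    apply: (lebesgue_aeS aex) => r H; rewrite in_itv /= => /andP[r1 r2]; apply: H.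
    move: Dr; rewrite ler_norml in_itv /= => /andP[D1 D2].
    by clear - r1 r2 D1 D2 r0T hT; apply/andP; split; lra.
  have eC0 : 0 <= e * C by rewrite mulr_ge0 // ltW.
  have := ae_shadow (ltW L0) B0 eC0 DT FB FL (acx _ _) cxe aeD dY (t := t + D).
  have -> : D + T - D = T by rewrite addrC addKr.
  rewrite addrK; apply.
  by move: tT; rewrite !in_itv /= lerDr addrC lerD2l.
pose Mv := 2 * (G * (C * T)) / om.
have vsmall e : e \in `]0, eps0] -> `|(z e).2| <= Mv * e.
  move=> eI; have [[DI vI xU] _] := Hz e eI.
  have ge := goodP _ eI; have [cxe acx pxe /all_and2[cl xK] aex] := approx _ ge.
  move: DI vI xU; rewrite !inr; move: (z e).1 (z e).2 => D v Dr vr xU.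
  have dY (t : R) : is_derive t 1 (fun t => U v (t - (- T))) (F (U v (t - (- T)))).
    exact: is_derive1_shift.
  have v0 : `|0 : R| <= d2 by rewrite normr0 ltW.
  have [_] := Hd2 0 v T v0 (le_trans vr r0d2) TI.
  have [_] := Hd2 0 v (T + T) v0 (le_trans vr r0d2) TTI.
  rewrite !subr0 !Ux0 // px0 => h1 h2.
  (* At [t = T] periodicity returns [x e (T + D)] to [x e D = U v T], while the shadow has moved on
     to [U v (T + T)]. *)
  have h3 : `|U v T - U v (T + T)| <= G * (e * C * T).
    have := shadow e _ D T ge Dr dY; rewrite in_itv /= lexx ltW // => /(_ isT).
    by rewrite [T + D]addrC pxe xU !opprK add0r subrr normr0 add0r.
  have : `|v *: (w (T + T) - w T)| <= om / 4 * `|v| + om / 4 * `|v| + G * (e * C * T).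
    have -> : v *: (w (T + T) - w T) = (U v T - x0 T - v *: w T)
        - (U v (T + T) - x0 T - v *: w (T + T)) - (U v T - U v (T + T)).
      rewrite scalerBr !opprB.
      by rewrite [RHS](AC (3*(1*2)*2) (4*3*(1*8)*(5*2)*(7*6)))/= !subrr !addr0.
    apply: (le_trans (ler_normB _ _)); apply: lerD => //.
    by apply: (le_trans (ler_normB _ _)); apply: lerD.
  rewrite normrZ -/om => h4.
  rewrite /Mv mulrAC ler_pdivlMr //; lra.
have cvg0 (y : R -> R) :
    (forall e, e \in `]0, eps0] -> `|y e| <= 2 * k * `|x e 0 - x0 0|) ->
    y @ 0^'+ --> (0 : R).
  move=> yb; apply/cvgrPdist_lt => eta eta0.
  have h1 : \forall e \near (0 : R)^'+, e <= eps0 by exact: nbhs_right_le.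
  have h2 : \forall e \near (0 : R)^'+, 0 < e by exact: nbhs_right_gt.
  have eta1 : 0 < eta / (2 * k + 1) by rewrite divr_gt0.
  apply: (filterS _ (filterI (filterI h1 h2) (hconv _ eta1))) => e [[e1 e0] H].
  rewrite sub0r normrN; apply: (le_lt_trans (yb e _)).
    by rewrite in_itv /= e0.
  have := H 0; rewrite in_itv /= lexx ltW // => /(_ isT).
  rewrite ltr_pdivlMr // mulrC; apply: le_lt_trans.
  by rewrite ler_wpM2r // lerDl.
(* By the linearization at [v = 0], [|U v T - x0 0| <= Mw * |v|]. The summand 1 in [M] only secures
   positivity. *)
pose Mw := `|w T| + s.
pose M := G * (Mw * Mv + C * T) + 1.
exists eps0, r0, M; split.
  split=> //; rewrite /M ltr_wpDl // !(mulr_ge0, addr_ge0, invr_ge0) // ltW //.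
exists (fun e => (z e).1), (fun e => (z e).2); split.
- move=> e eI; have [[DI vI xU] [_ _ uni]] := Hz e eI.
  split.
    have [Sd SE] := SU _ (etrans (esym (inr _)) vI).
    by split=> //; rewrite SE.
  move=> D v [D1 v1 Sd xS]; apply: uni => //.
  by have [_ <-] := SU v (etrans (esym (inr _)) v1).
- by apply: cvg0 => e /Hz[_ []].
- by apply: cvg0 => e /Hz[_ []].
move=> e eI t tT; have [[DI vI xU] _] := Hz e eI.
have ge := goodP _ eI.
have h := shadow e x0 (z e).1 t ge (etrans (esym (inr _)) DI) dx0F tT.
apply: (le_trans h); move: (vsmall e eI) vI; rewrite xU inr.
move: (z e).2 => v vM vr.
have v0 : `|0 : R| <= d1 by rewrite normr0 ltW.
have [_] := Hd1 0 v T v0 (le_trans vr r0d1) TI.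
rewrite subr0 Ux0 // -[in x0 T](add0r T) px0 => h1.
have h2 : `|U v T - x0 0| <= Mw * (Mv * e).
  rewrite -(subrK (v *: w T) (U v T - x0 0)); apply: (le_trans (ler_normD _ _)).
  rewrite normrZ; apply: (@le_trans _ _ (Mw * `|v|)); first by rewrite /Mw; lra.
  by rewrite ler_wpM2l // /Mw addr_ge0 // ltW.
have [e0 _ _ _ _] := ge.
apply: (@le_trans _ _ (G * (Mw * (Mv * e) + e * C * T))).
  by rewrite ler_wpM2l ?(ltW G0) // lerD2r.
by rewrite /M; lra.
Qed.
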